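(* Let $n\ge 2$ be even, let $\mathbf r=(1,1,\dots,1)\in\mathbb Z^n$, let $C_m=\frac{(2m)!}{(m+1)!\,m!}$, and let $N=C_{n/2}-1$. If $n\ge 8$, then the image of the Kempe embedding $M_{\mathbf r}\to\mathbb{CP}^N$ is not a complete intersection. If $n\in\{2,4,6\}$, the image is a complete intersection.
   Context: In $\mathbb C[x_1,y_1,\dots,x_n,y_n]$ let $p_{ij}=x_iy_j-x_jy_i$. A $2\times k$ tableau with top row $(i_1,\dots,i_k)$ and bottom row $(j_1,\dots,j_k)$, with entries in $\{1,\dots,n\}$, is identified with $\prod_l p_{i_lj_l}$; it is semistandard if columns strictly increase and rows weakly increase. For $\mathbf r=(1,\dots,1)$ and $n$ even, $R_{\mathbf r}=\bigoplus_{k\ge 0}R_{\mathbf r}^{(k)}$, where $R_{\mathbf r}^{(k)}$ is the $\mathbb C$-span of the $2\times(kn/2)$ tableaux in which each of $1,\dots,n$ occurs exactly $k$ times. $M_{\mathbf r}=\mathrm{Proj}\,R_{\mathbf r}=(\mathbb{CP}^1)^n/\!/_{\mathbf r}\,\mathrm{SL}(2,\mathbb C)$. The ring $R_{\mathbf r}$ is generated by $R_{\mathbf r}^{(1)}$, which has as basis the $C_{n/2}=N+1$ semistandard $2\times (n/2)$ tableaux in which each of $1,\dots,n$ occurs once. The corresponding surjection $\mathbb C[X_0,\dots,X_N]\to R_{\mathbf r}$ defines a closed embedding $M_{\mathbf r}\to\mathbb{CP}^N$, the Kempe embedding. ''Complete intersection'' means that the homogeneous ideal $\ker(\mathbb C[X_0,\dots,X_N]\to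 R_{\mathbf r})$ can be generated by exactly $N+1-\dim R_{\mathbf r}$ (the codimension) homogeneous polynomials, where $\dim$ is Krull dimension. *)

(* Defs.v *)
From HB Require Import structures.
From mathcomp Require Import all_boot all_order all_algebra.
From mathcomp Require Import ring_quotient boolp reals complex mpoly.
Set Implicit Arguments.
Unset Strict Implicit.
Unset Printing Implicit Defensive.
Import Order.TTheory GRing.Theory Num.Theory.
Local Open Scope ring_scope.

Definition catalan (m : nat) : nat := ((2 * m)`! %/ ((m.+1)`! * m`!))%N.

(* Ideals are decidable predicates in the library; with boolp every set of ring
   elements is one. *)
Definition prime_ideal (A : comNzRingType) (P : {pred A}) : Prop :=
  idealr_closed P /\ prime_idealr_closed P.

(* A chain P_0 < P_1 < ... < P_d of primes, with d strict inclusions. *)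
Definition has_prime_chain (A : comNzRingType) (d : nat) : Prop :=
  exists P : nat -> {pred A},
    (forall i, (i <= d)%N -> prime_ideal (P i)) /\
    (forall i, (i < d)%N ->
       {subset P i <= P i.+1} /\ exists2 a, a \in P i.+1 & a \notin P i).

Definition krull_dim_is (A : comNzRingType) (d : nat) : Prop :=
  has_prime_chain A d /\ forall e, has_prime_chain A e -> (e <= d)%N.

Definition homogeneous_poly (K : nzRingType) (m : nat) (p : {mpoly K[m]}) : Prop :=
  exists d : nat, p \is d.-homog.

Definition generates_ideal (K : comNzRingType) (m c : nat)
    (f : 'I_c -> {mpoly K[m]}) (I : {mpoly K[m]} -> Prop) : Prop :=
  forall p, I p <-> exists q : 'I_c -> {mpoly K[m]}, p = \sum_(i < c) q i * f i.

(* A 2 x k tableau is given by its columns (top entry, bottom entry); the entries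
   1, ..., n are represented by the elements 0, ..., n.-1 of 'I_n. *)
Notation tableau n k := (k.-tuple ('I_n * 'I_n)).

Section Tableaux.
Variable n : nat.

Definition top_row k (t : tableau n k) : seq 'I_n := unzip1 t.
Definition bottom_row k (t : tableau n k) : seq 'I_n := unzip2 t.

Definition semistandard k (t : tableau n k) : bool :=
  [&& all (fun c : 'I_n * 'I_n => (c.1 < c.2)%N) t,
      sorted leq (map val (top_row t)) & sorted leq (map val (bottom_row t))].

(* Each of the n symbols occurs exactly l times in the tableau. *)
Definition equicontent l k (t : tableau n k) : bool :=
  [forall i, count_mem i (top_row t ++ bottom_row t) == l].

Definition basis_tableaux : {set tableau n n./2} :=
  [set t | semistandard t && equicontent 1 t].

Variable K : fieldType.

(* In K[x_1, y_1, ..., x_n, y_n] the x_i are the first n variables, the y_i the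
   last n. *)
Definition varx (i : 'I_n) : {mpoly K[n + n]} := 'X_(lshift n i).
Definition vary (i : 'I_n) : {mpoly K[n + n]} := 'X_(rshift n i).

Definition pbracket (c : 'I_n * 'I_n) : {mpoly K[n + n]} :=
  varx c.1 * vary c.2 - varx c.2 * vary c.1.

Definition tableau_poly k (t : tableau n k) : {mpoly K[n + n]} :=
  \prod_(c <- t) pbracket c.

(* For n even, k * n./2 = kn/2. *)
Definition graded_piece (k : nat) (p : {mpoly K[n + n]}) : Prop :=
  exists a : tableau n (k * n./2) -> K,
    p = \sum_(t | equicontent k t) a t *: tableau_poly t.

Definition invariant_ring_pred : {pred {mpoly K[n + n]}} :=
  fun p => `[< exists m (r : nat -> {mpoly K[n + n]}),
               (forall k, graded_piece k (r k)) /\ p = \sum_(k < m) r k >].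

Lemma graded_piece0 k : graded_piece k 0.
Proof. by exists (fun=> 0); rewrite big1 // => t _; rewrite scale0r. Qed.

Lemma graded_pieceD k p q :
  graded_piece k p -> graded_piece k q -> graded_piece k (p + q).
Proof.
move=> [a ->] [b ->]; exists (fun t => a t + b t).
by rewrite -big_split; apply: eq_bigr => t _; rewrite scalerDl.
Qed.

Lemma graded_pieceZ k c p : graded_piece k p -> graded_piece k (c *: p).
Proof.
move=> [a ->]; exists (fun t => c * a t).
by rewrite scaler_sumr; apply: eq_bigr => t _; rewrite scalerA.
Qed.

Lemma graded_piece_sum k (I : Type) (s : seq I) (P : pred I) F :
  (forall i, P i -> graded_piece k (F i)) ->
  graded_piece k (\sum_(i <- s | P i) F i).
Proof.
move=> FP; apply: (big_ind (graded_piece k)) => //.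
- exact: graded_piece0.
- exact: graded_pieceD.
Qed.

Lemma graded_piece_tableau k (t : tableau n (k * n./2)) :
  equicontent k t -> graded_piece k (tableau_poly t).
Proof.
move=> tk; exists (fun u => (u == t)%:R).
rewrite (bigD1 t) //= eqxx scale1r big1 ?addr0 // => u /andP[_ /negPf->].
by rewrite scale0r.
Qed.

Lemma graded_pieceM k l p q :
  graded_piece k p -> graded_piece l q -> graded_piece (k + l) (p * q).
Proof.
move=> [a ->] [b ->]; rewrite mulr_suml.
apply: graded_piece_sum => t tk; rewrite mulr_sumr.
apply: graded_piece_sum => u ul; rewrite -scalerAl -scalerAr.
do 2 apply: graded_pieceZ.
have E : (k * n./2 + l * n./2)%N = ((k + l) * n./2)%N by rewrite mulnDl.
pose w := tcast E (cat_tuple t u).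
have wE : tval w = tval t ++ tval u by rewrite /w val_tcast.
have -> : tableau_poly t * tableau_poly u = tableau_poly w.
  by rewrite /tableau_poly wE big_cat.
apply: graded_piece_tableau; apply/forallP => i.
move/forallP: tk => /(_ i)/eqP; move/forallP: ul => /(_ i)/eqP.
rewrite /top_row /bottom_row wE /unzip1 /unzip2 !map_cat !count_cat => iu it.
by rewrite addnACA it iu.
Qed.

Lemma graded_piece1 : graded_piece 0 1.
Proof.
have -> : (1 : {mpoly K[n + n]}) = tableau_poly [tuple of [::]].
  by rewrite /tableau_poly big_nil.
by apply: (@graded_piece_tableau 0); apply/forallP.
Qed.

Lemma invariant_ring_predD p q :
  p \in invariant_ring_pred -> q \in invariant_ring_pred ->
  p + q \in invariant_ring_pred.
Proof.
move=> /asboolP[m [r [rP ->]]] /asboolP[m' [s [sP ->]]]; apply/asboolP.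
pose tr M (f : nat -> {mpoly K[n + n]}) k := if (k < M)%N then f k else 0.
have trE M M' (f : nat -> {mpoly K[n + n]}) :
      \sum_(k < M) f k = \sum_(k < M + M') tr M f k.
  rewrite big_split_ord /= [X in _ + X]big1 ?addr0.
    by apply: eq_bigr => k _; rewrite /tr ltn_ord.
  by move=> k _; rewrite /tr ltnNge leq_addr.
exists (m + m')%N, (fun k => tr m r k + tr m' s k); split.
  move=> k; apply: graded_pieceD; rewrite /tr; case: ifP => // _;
  exact: graded_piece0.
by rewrite (trE m m') (trE m' m) [(m' + m)%N]addnC -big_split.
Qed.

Lemma graded_piece_invariant k p :
  graded_piece k p -> p \in invariant_ring_pred.
Proof.
move=> pk; apply/asboolP.
exists k.+1, (fun i => if i == k then p else 0); split.
  by move=> i; case: eqP => [->|_] //; exact: graded_piece0.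
rewrite big_ord_recr /= eqxx big1 ?add0r // => i _.
by rewrite ltn_eqF.
Qed.

Lemma invariant_ring_subring : subring_closed invariant_ring_pred.
Proof.
have inv_sum (I : Type) (s : seq I) (F : I -> {mpoly K[n + n]}) :
    (forall i, F i \in invariant_ring_pred) ->
    \sum_(i <- s) F i \in invariant_ring_pred.
  move=> FP; apply: (big_ind (fun p => p \in invariant_ring_pred)) => //.
  - exact: graded_piece_invariant (graded_piece0 0).
  - exact: invariant_ring_predD.
split.
- exact: graded_piece_invariant graded_piece1.
- move=> p q pP /asboolP[m [r [rP ->]]]; apply: invariant_ring_predD => //.
  rewrite -sumrN; apply: (inv_sum) => k; rewrite -scaleN1r.
  exact: graded_piece_invariant (graded_pieceZ _ (rP k)).
- move=> p q /asboolP[m [r [rP ->]]] /asboolP[m' [s [sP ->]]].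
  rewrite mulr_suml; apply: (inv_sum) => k; rewrite mulr_sumr.
  apply: (inv_sum) => l.
  exact: graded_piece_invariant (graded_pieceM (rP k) (sP l)).
Qed.

HB.instance Definition _ :=
  GRing.isSubringClosed.Build _ invariant_ring_pred invariant_ring_subring.

(* R_r for r = (1, ..., 1), as a subring of K[x_1, y_1, ..., x_n, y_n]. *)
Record invariant_ring := InvariantRing {
  inv_val : {mpoly K[n + n]};
  _ : inv_val \in invariant_ring_pred
}.

HB.instance Definition _ := [isSub for inv_val].
HB.instance Definition _ := [Choice of invariant_ring by <:].
HB.instance Definition _ := [SubChoice_isSubComNzRing of invariant_ring by <:].

(* The map K[X_0, ..., X_N] -> R_r sending X_i to the i-th tableau of T, composed
   with the inclusion of R_r in K[x_1, y_1, ..., x_n, y_n]. *)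
Definition kempe_map N (T : N.+1.-tuple (tableau n n./2))
    (p : {mpoly K[N.+1]}) : {mpoly K[n + n]} :=
  p \mPo map_tuple (@tableau_poly (n./2)) T.

Definition kempe_ideal N (T : N.+1.-tuple (tableau n n./2))
    (p : {mpoly K[N.+1]}) : Prop := kempe_map T p = 0.

Definition kempe_complete_intersection N
    (T : N.+1.-tuple (tableau n n./2)) : Prop :=
  exists d c : nat,
    [/\ krull_dim_is invariant_ring d, (c + d = N.+1)%N &
        exists f : 'I_c -> {mpoly K[N.+1]},
          (forall i, homogeneous_poly (f i)) /\
          generates_ideal f (kempe_ideal T)].

End Tableaux.

(* Main.v *)
Require Import Defs.
From mathcomp Require Import all_boot all_order all_algebra.
From mathcomp Require Import reals complex mpoly.
From HB Require Import structures.
From mathcomp Require Import ring_quotient boolp zify ring.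

(** Everything about the ring R_r rests on its semistandard tableaux. If two
    columns (i, l) and (j, k) are nested, i < j < k < l, the Pluecker relation
    replaces them by (i, k), (j, l) and (i, j), (k, l), which lowers the sum of
    the squared column lengths; hence semistandard tableaux span each graded
    piece (straighten). Such a tableau is determined by the number of times
    each symbol occurs in its top row (semistandard_inj), so they can be
    counted.

    Let n >= 8. Evaluating at configurations that consist of copies of two
    points only shows that the basis tableaux are linearly independent
    (basis_independent), so the ideal contains no nonzero form of degree less
    than 2. Its quadrics are therefore linear combinations of the generators of
    degree 2, and c generators leave room for at most c independent quadrics
    (quadrics_dim). On the other hand the quadrics of the ideal have dimension
    at least C(N + 2, 2) - r, where r is the number of semistandard tableaux of
    content (2, ..., 2), a Riordan number. With m = n/2 - 4 one has
    r <= 91 * 9^m (riordan_le) and N + 1 >= 14 * 3^m (catalan_ge), and these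
    give C(N + 2, 2) - r >= N + 1. As the Krull dimension d is at least 1, the
    codimension c = N + 1 - d is at most N: a contradiction. For n = 8 the count
    is tight, 105 - 91 = 14 = N + 1.

    Let n be 2, 4 or 6; then d = 1, 2, 4. The count of semistandard tableaux
    bounds the dimension of the elements of degree at most k by (k + 1)^d, so
    any d + 1 elements are algebraically dependent, and an algebraic relation
    excludes longer chains of primes: along a chain, its lexicographically
    smallest term would end up as a nonzero scalar in a prime ideal
    (prime_chain_independent). Chains of length d arise by specialising a
    family of configurations step by step (has_prime_chain_param). For n = 2
    and n = 4 the basis tableaux take arbitrary values, so the ideal is zero.
    For n = 6 it is generated by the Segre cubic
    X_a (X_e X_b - X_c X_d) = X_b (X_d - X_e) (X_e - X_c).
    The vertex of the coordinate a is a node of the cubic, where the six points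
    collide three by three, which is why the cubic is linear in X_a. Projecting
    from the node, the other four coordinates take general values, and
    pseudo-division by a polynomial linear in X_a shows that every element of
    the ideal is a multiple of the cubic (linear_hypersurface, used once for the
    quadric X_e X_b - X_c X_d, which is linear in X_e, and once for the cubic). *)

Set Implicit Arguments.
Unset Strict Implicit.
Unset Printing Implicit Defensive.
Import Order.TTheory GRing.Theory Num.Theory.

(** * Polynomials vanishing at general points *)
Lemma base_digits_inj B n (m m' : nat -> nat) :
  (forall i, i < n -> m i < B) -> (forall i, i < n -> m' i < B) ->
  \sum_(i < n) m i * B ^ i = \sum_(i < n) m' i * B ^ i ->
  forall i, i < n -> m i = m' i.
Proof.
elim: n m m' => // n IH m m' mB m'B; rewrite !big_ord_recl !muln1.
have shift (f : nat -> nat) : \sum_(i < n) f (bump 0 i) * B ^ bump 0 i =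
    (\sum_(i < n) f i.+1 * B ^ i) * B.
  by rewrite big_distrl; apply: eq_bigr => i _; rewrite /bump /= add1n expnSr mulnA.
rewrite /= !shift => E.
have B0 : 0 < B by apply: leq_ltn_trans (mB 0 _).
have E0 : m 0 = m' 0.
  by have := congr1 (modn^~ B) E; rewrite /= ![_ + _ * B]addnC !modnMDl !modn_small ?mB ?m'B.
case=> [|i] // lin.
apply: (IH (fun i => m i.+1) (fun i => m' i.+1)) => // [j jn|j jn|]; first exact: mB.
  exact: m'B.
by move: E; rewrite E0 => /addnI/eqP; rewrite eqn_pmul2r // => /eqP.
Qed.

Section Vanishing.
Local Open Scope ring_scope.
Variable K : numFieldType.

(** Kronecker's substitution X_i = t^(B^i), with B above all exponents, sends
    distinct monomials to distinct powers of t. A nonzero p thus becomes a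
    nonzero polynomial in t, which has only finitely many of the natural numbers
    as roots. *)
Lemma mpoly_vanish n (p : {mpoly K[n]}) : (forall v, p.@[v] = 0) -> p = 0.
Proof.
move=> p0; pose B := msize p.
pose e (m : 'X_{1..n}) := (\sum_(i < n) m i * B ^ i)%N.
pose q : {poly K} := \sum_(m <- msupp p) p@_m *: 'X^(e m).
have qt t : q.[t] = 0.
  rewrite -(p0 (fun i : 'I_n => t ^+ (B ^ i))) mevalE horner_sum.
  apply: eq_bigr => m _; rewrite hornerZ hornerXn; congr (_ * _).
  rewrite /e -prodrXr; apply: eq_bigr => i _.
  by rewrite mulnC exprM.
have q0 : q = 0.
  apply/eqP; apply: contraT => qn0.
  have := max_poly_roots (rs := [seq k%:R | k <- iota 0 (size q)]) qn0.
  rewrite size_map size_iota ltnn => -> //; first by apply/allP => x _; apply/eqP.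
  by rewrite map_inj_uniq ?iota_uniq //; apply: mulrIn; rewrite oner_eq0.
have digit m : m \in msupp p -> forall i : 'I_n, (m i < B)%N.
  move=> mp i; apply: leq_ltn_trans (msize_mdeg_lt mp).
  by rewrite mdegE (bigD1 i) //= leq_addr.
apply/mpolyP => m; rewrite mcoeff0.
case mp: (m \in msupp p); last by apply: memN_msupp_eq0; rewrite mp.
have := congr1 (fun r : {poly K} => r`_(e m)) q0.
rewrite coef0 coef_sum (bigD1_seq m) //= coefZ coefXn eqxx mulr1 big_seq_cond.
rewrite big1 ?addr0 // => m' /andP[m'p nm].
rewrite coefZ coefXn; case: eqP => [E|]; last by rewrite mulr0.
case/eqP: nm; apply/mnmP => i.
pose f (m1 : 'X_{1..n}) k := if insub k is Some j then m1 (j : 'I_n) else 0%N.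
have fE (m1 : 'X_{1..n}) (j : 'I_n) : f m1 j = m1 j by rewrite /f valK.
rewrite -!fE; apply: (@base_digits_inj B n (f m') (f m)) => //.
- by move=> k kn; rewrite -[k]/(val (Ordinal kn)) fE digit.
- by move=> k kn; rewrite -[k]/(val (Ordinal kn)) fE digit.
- by rewrite (eq_bigr _ (fun j _ => congr1 (muln^~ _) (fE m' j)))
    (eq_bigr _ (fun j _ => congr1 (muln^~ _) (fE m j))).
Qed.

(** Allows points to be chosen in general position: D collects the denominators
    and the degenerate cases. *)
Lemma mpoly_vanish_off n (D p : {mpoly K[n]}) :
  D != 0 -> (forall v, D.@[v] != 0 -> p.@[v] = 0) -> p = 0.
Proof.
move=> D0 Dp; apply: (mulfI D0); rewrite mulr0; apply: mpoly_vanish => v.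
by rewrite mevalM; have [->|/Dp ->] := eqVneq D.@[v] 0; rewrite ?mul0r ?mulr0.
Qed.
End Vanishing.

(** * Linear maps with image in the span of few vectors *)
Section Dimension.
Local Open Scope ring_scope.
Variable K : fieldType.

(** The g j may be linearly dependent, so the coefficients of psi u are not a
    function linear in u a priori. They are chosen on a basis of U and extended
    linearly to a map L to row vectors; the kernel of L is the required W. *)
Lemma large_kernel (U : vectType K) (V : lmodType K) (psi : {linear U -> V})
    (J : finType) (g : J -> V) :
  (forall u, exists a : J -> K, psi u = \sum_j a j *: g j) ->
  exists2 W : {vspace U}, (\dim {:U} <= \dim W + #|J|)%N &
    forall w, w \in W -> psi w = 0.
Proof.
move=> /choice[a aP].
pose b := vbasis {:U}; pose m := #|J|.
pose L (u : U) : 'rV[K]_m :=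
  \sum_i coord b i u *: \row_j a b`_i (enum_val j).
have L_lin : linear L.
  move=> c u v; rewrite /L scaler_sumr -big_split; apply: eq_bigr => i _ /=.
  by rewrite linearP scalerDl scalerA.
pose HL := GRing.isLinear.Build _ _ _ _ L L_lin.
pose Ll : {linear U -> 'rV[K]_m} := HB.pack L HL.
exists (lker (linfun Ll)).
  rewrite -(limg_ker_dim (linfun Ll) fullv) capfv leq_add2l.
  by rewrite (leq_trans (dimvS (subvf _))) // dimvf /dim /= mul1n.
move=> w; rewrite memv_ker lfunE => /eqP Lw.
rewrite (coord_vbasis (memvf w)) linear_sum /=.
transitivity (\sum_(i < \dim {:U}) \sum_j (coord b i w * a b`_i j) *: g j).
  apply: eq_bigr => i _; rewrite linearZ /= aP scaler_sumr.
  by apply: eq_bigr => j _; rewrite scalerA.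
rewrite exchange_big big1 // => j _; rewrite -scaler_suml.
move/rowP: Lw => /(_ (enum_rank j)); rewrite summxE !mxE.
under eq_bigr do rewrite !mxE enum_rankK.
by move=> ->; rewrite scale0r.
Qed.

Lemma linear_dependence (I J : finType) (V : lmodType K) (v : I -> V)
    (g : J -> V) :
  (#|J| < #|I|)%N ->
  (forall i, exists a : J -> K, v i = \sum_j a j *: g j) ->
  exists2 c : I -> K, (exists i, c i != 0) & \sum_i c i *: v i = 0.
Proof.
move=> JI /choice[a aP].
pose psi (u : 'rV[K]_#|I|) := \sum_i u 0 (enum_rank i) *: v i.
have psi_lin : linear psi.
  move=> c u w; rewrite /psi scaler_sumr -big_split; apply: eq_bigr => i _ /=.
  by rewrite !mxE scalerDl scalerA.
pose Hpsi := GRing.isLinear.Build _ _ _ _ psi psi_lin.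
pose psil : {linear 'rV[K]_#|I| -> V} := HB.pack psi Hpsi.
have [|W dW W0] := @large_kernel _ _ psil _ g.
  move=> u; exists (fun j => \sum_i u 0 (enum_rank i) * a i j).
  transitivity (\sum_i \sum_j (u 0 (enum_rank i) * a i j) *: g j).
    apply: eq_bigr => i _; rewrite aP scaler_sumr.
    by apply: eq_bigr => j _; rewrite scalerA.
  by rewrite exchange_big; apply: eq_bigr => j _; rewrite scaler_suml.
have Wn0 : W != 0%VS.
  apply: contraTneq dW => ->; rewrite dimv0 add0n -ltnNge.
  by rewrite dimvf /dim /= mul1n.
exists (fun i => vpick W 0 (enum_rank i)); last exact: W0 (memv_pick W).
have : vpick W != 0 by rewrite vpick0.
case/rV0Pn => i ci; exists (enum_val i); by rewrite enum_valK.
Qed.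
End Dimension.

(** * Chains of primes and algebraic dependence *)
Section Krull.
Local Open Scope ring_scope.

Lemma big_tuple_cons (V : nmodType) (T : finType) d (F : d.+1.-tuple T -> V) :
  \sum_t F t = \sum_k \sum_(t : d.-tuple T) F [tuple of k :: t].
Proof.
rewrite pair_bigA /=; apply: (reindex (fun p : T * d.-tuple T => [tuple of p.1 :: p.2])).
exists (fun t => (thead t, [tuple of behead t])) => [[k t] _|t _] /=.
  by congr (_, _); apply: val_inj.
by rewrite -tuple_eta.
Qed.

Variables (A : comNzRingType) (K : fieldType) (iota : {rmorphism K -> A}).
Implicit Types P : nat -> {pred A}.

Lemma prime_idealN (Q : {pred A}) u v :
  prime_ideal Q -> u * v \in Q -> u \notin Q -> v \in Q.
Proof. by move=> [_ Qp] /Qp /orP[->|]. Qed.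

Lemma prime_ideal_exp (Q : {pred A}) u v k :
  prime_ideal Q -> u ^+ k * v \in Q -> u \notin Q -> v \in Q.
Proof.
move=> Qp; elim: k => [|k IH]; first by rewrite mul1r.
rewrite exprS -mulrA => uv uQ; apply: IH => //; exact: prime_idealN uv uQ.
Qed.

(** The elementary form, due to Coquand and Lombardi, of the bound of the Krull
    dimension by the transcendence degree. Suppose that the sum lies in P 0 and
    let k be the least exponent of x 0 in it. Since x 0 is not in P 0, the power
    x 0 ^ k can be cancelled; since x 0 is in P 1, modulo P 1 only the
    coefficient S k of x 0 ^ k remains. It is a sum of the same kind in the later
    elements, for the chain starting at P 1. After the last step a nonzero scalar
    would lie in a prime ideal. *)
Lemma prime_chain_independent d P (x : nat -> A) M (c : d.-tuple 'I_M -> K) :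
  (forall i, (i <= d)%N -> prime_ideal (P i)) ->
  (forall i, (i < d)%N -> [/\ {subset P i <= P i.+1}, x i \in P i.+1 & x i \notin P i]) ->
  (exists t, c t != 0) ->
  \sum_t iota (c t) * \prod_(i < d) x i ^+ tnth t i \notin P 0.
Proof.
elim: d P x c => [|d IH] P x c Pp Px [t ct].
  rewrite (big_pred1 t) => [|t']; last by rewrite (tuple0 t) (tuple0 t') /= eqxx.
  rewrite big_ord0 mulr1; have [[_ P1 Pl] _] := Pp 0%N isT.
  apply: contra P1 => ctP; have -> : 1 = iota (c t)^-1 * iota (c t) + 0.
    by rewrite addr0 -rmorphM mulVf // rmorph1.
  by apply: Pl => //; have [[]] := Pp 0%N isT.
have [xP x1 x0] := Px 0%N isT.
pose S (k : 'I_M) := \sum_(t : d.-tuple 'I_M)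
  iota (c [tuple of k :: t]) * \prod_(i < d) x i.+1 ^+ tnth t i.
have -> : \sum_t iota (c t) * \prod_(i < d.+1) x i ^+ tnth t i =
    \sum_(k < M) x 0%N ^+ k * S k.
  rewrite big_tuple_cons; apply: eq_bigr => k _; rewrite /S mulr_sumr.
  apply: eq_bigr => t' _; rewrite big_ord_recl /= mulrCA; congr (_ * (_ * _)).
  by apply: eq_bigr => i _; rewrite tnthS.
have Sne (k : 'I_M) : (exists t' : d.-tuple 'I_M, c [tuple of k :: t'] != 0) -> S k \notin P 1%N.
  move=> kt; apply: (IH (fun i => P i.+1) (fun i => x i.+1)) => // i id.
    exact: Pp.
  exact: Px.
pose good k := [exists t' : d.-tuple 'I_M, c [tuple of k :: t'] != 0].
have good_t : good (thead t).
  by apply/existsP; exists [tuple of behead t]; rewrite -tuple_eta.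
case: (arg_minnP (P := good) (fun k : 'I_M => k : nat) good_t) => k /existsP kt kmin.
have S0 (j : 'I_M) : (j < k)%N -> S j = 0.
  move=> jk; apply: big1 => t' _.
  have [->|cn0] := eqVneq (c [tuple of j :: t']) 0; first by rewrite rmorph0 mul0r.
  have /kmin : good j by apply/existsP; exists t'.
  by rewrite leqNgt jk.
apply: contra (Sne k kt).
have -> : \sum_(j < M) x 0%N ^+ j * S j =
    x 0%N ^+ k * (S k + x 0%N * \sum_(j < M | (k < j)%N) x 0%N ^+ (j - k.+1) * S j).
  rewrite (bigID (fun j : 'I_M => (j <= k)%N)) /= (bigD1 k) //=.
  rewrite [X in _ + X + _]big1 ?addr0; last first.
    by move=> j /andP[jk nk]; rewrite S0 ?mulr0 // ltn_neqAle jk andbT.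
  rewrite mulrDr; congr (_ + _); rewrite mulrA -exprSr mulr_sumr.
  under eq_bigl do rewrite -ltnNge.
  by apply: eq_bigr => j jk; rewrite mulrA -exprD subnKC.
move=> /(prime_ideal_exp (Pp 0%N isT)) /(_ x0) /xP SP.
have [[_ _ Pl] _] := Pp 1%N isT.
set b := \sum_(j < M | _) _ in SP.
have := Pl (- b) _ _ x1 SP.
by rewrite mulNr [X in - X]mulrC [S k + _]addrC addKr.
Qed.

Lemma krull_dim_le_trdeg D :
  (forall x : 'I_D.+1 -> A, exists M (c : D.+1.-tuple 'I_M -> K),
     (exists t, c t != 0) /\ \sum_t iota (c t) * \prod_i x i ^+ tnth t i = 0) ->
  forall e, has_prime_chain A e -> (e <= D)%N.
Proof.
move=> dep e [P [Pp Pe]]; rewrite leqNgt; apply/negP => De.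
have /choice[x xP] (i : nat) : exists a, (i < e)%N -> a \in P i.+1 /\ a \notin P i.
  have [/Pe[_ [a a1 a2]]|//] := ltnP i e; first by exists a.
  by exists 0.
have [M [c [ct c0]]] := dep (fun i => x i).
have Pp' i : (i <= D.+1)%N -> prime_ideal (P i).
  by move=> iD; apply: Pp; apply: leq_trans iD De.
have Px i : (i < D.+1)%N -> [/\ {subset P i <= P i.+1}, x i \in P i.+1 & x i \notin P i].
  move=> iD; have ie := leq_trans iD De.
  by have [? ?] := xP i ie; have [? _] := Pe i ie.
have := prime_chain_independent Pp' Px ct; rewrite c0.
by have [[-> //]] := Pp 0%N isT.
Qed.
End Krull.

(** * Straightening *)
Section Straightening.
Local Open Scope ring_scope.
Variables (n : nat) (K : fieldType).
Local Notation column := ('I_n * 'I_n)%type.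
Implicit Types (c : column) (s : seq column).

Definition bracket_monomial s : {mpoly K[n + n]} := \prod_(c <- s) pbracket K c.

Definition entries s : seq 'I_n := unzip1 s ++ unzip2 s.

Definition semistandard_span l m (p : {mpoly K[n + n]}) : Prop :=
  exists a : tableau n m -> K,
    p = \sum_(t | semistandard t && equicontent l t) a t *: tableau_poly K t.

Lemma semistandard_span0 l m : semistandard_span l m 0.
Proof. by exists (fun=> 0); rewrite big1 // => t _; rewrite scale0r. Qed.

Lemma semistandard_spanD l m p q : semistandard_span l m p -> semistandard_span l m q -> semistandard_span l m (p + q).
Proof.
move=> [a ->] [b ->]; exists (fun t => a t + b t).
by rewrite -big_split; apply: eq_bigr => t _; rewrite scalerDl.
Qed.

Lemma semistandard_spanZ l m e p : semistandard_span l m p -> semistandard_span l m (e *: p).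
Proof.
move=> [a ->]; exists (fun t => e * a t).
by rewrite scaler_sumr; apply: eq_bigr => t _; rewrite scalerA.
Qed.

Lemma semistandard_span_tableau l m (t : tableau n m) :
  semistandard t -> equicontent l t -> semistandard_span l m (tableau_poly K t).
Proof.
move=> ts tl; exists (fun u => (u == t)%:R).
rewrite (bigD1 t) ?ts //= eqxx scale1r big1 ?addr0 // => u /andP[_ /negPf->].
by rewrite scale0r.
Qed.

Lemma pbracketC (i j : 'I_n) : pbracket K (i, j) = - pbracket K (j, i).
Proof. by rewrite /pbracket opprB. Qed.

Lemma pbracket_plucker (i j k l : 'I_n) :
  pbracket K (i, l) * pbracket K (j, k) =
  pbracket K (i, k) * pbracket K (j, l) - pbracket K (i, j) * pbracket K (k, l).
Proof.
rewrite /pbracket /=.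
move: (varx _ _) (varx _ _) (varx _ _) (varx _ _) => xi xj xk xl.
move: (vary _ _) (vary _ _) (vary _ _) (vary _ _) => yi yj yk yl.
ring.
Qed.

Definition strict_columns s := all (fun c => c.1 < c.2)%N s.

Lemma bracket_monomial_orient s : bracket_monomial s = 0 \/
  exists e s', [/\ bracket_monomial s = e *: bracket_monomial s', strict_columns s',
    perm_eq (entries s') (entries s) & size s' = size s].
Proof.
elim: s => [|[i j] s IH].
  by right; exists 1, [::]; rewrite scale1r.
rewrite /bracket_monomial big_cons -/(bracket_monomial s).
case: IH => [->|[e [s' [-> s's ps ss]]]]; first by left; rewrite mulr0.
have pE (u v u' v' : 'I_n) : perm_eq [:: u; v] [:: u'; v'] ->
    perm_eq (entries ((u, v) :: s')) (entries ((u', v') :: s)).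
  move=> /permP uv; apply/permP => a; move/permP: ps => /(_ a); move: (uv a).
  by rewrite /entries /= !count_cat /=; lia.
case: (ltngtP i j) => [ij|ji|/val_inj <-].
- right; exists e, ((i, j) :: s'); split => //=; last by rewrite ss.
  + by rewrite /bracket_monomial big_cons scalerAr.
  + by rewrite ij.
  + exact: pE.
- right; exists (- e), ((j, i) :: s'); split => //=; last by rewrite ss.
  + by rewrite pbracketC /bracket_monomial big_cons mulNr scaleNr scalerAr.
  + by rewrite ji.
  + by apply: pE; rewrite (perm_catC [:: j] [:: i]).
- by left; rewrite /pbracket subrr mul0r.
Qed.

Definition nested c c' := (c.1 < c'.1)%N && (c'.2 < c.2)%N.

Definition column_le c c' := (c.1 < c'.1)%N || (c.1 == c'.1) && (c.2 <= c'.2)%N.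

Lemma column_le_total : total column_le.
Proof. by move=> [i j] [k l]; rewrite /column_le /= -!val_eqE /=; lia. Qed.

Lemma column_le_trans : transitive column_le.
Proof. by move=> [i j] [k l] [u v]; rewrite /column_le /= -!val_eqE /=; lia. Qed.

(** The measure for straightening: if i < j < k < l then (l-i)^2 + (k-j)^2 is
    larger than both (k-i)^2 + (l-j)^2 and (j-i)^2 + (l-k)^2. *)
Definition spread s := (\sum_(c <- s) (c.2 - c.1) ^ 2)%N.

Lemma tableau_poly_seq m (t : tableau n m) : tableau_poly K t = bracket_monomial t.
Proof. by []. Qed.

Lemma perm_entries s s' : perm_eq s s' -> perm_eq (entries s) (entries s').
Proof. by move=> p; apply: perm_cat; apply: perm_map. Qed.

(** In a lexicographically sorted list of columns the top entries increase, and
    a descent in the bottom row would make its two columns nested. *)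
Lemma sorted_unnested_semistandard m (t : tableau n m) :
  strict_columns t -> sorted column_le t ->
  {in tval t &, forall c c', ~~ nested c c'} -> semistandard t.
Proof.
move=> tst tsort tn; rewrite /semistandard /top_row /bottom_row.
apply/and3P; split => //.
  all: rewrite sorted_pairwise; last exact: leq_trans.
  all: rewrite sorted_pairwise in tsort; last exact: column_le_trans.
  all: rewrite -map_comp pairwise_map; move: tsort.
  all: apply: (@sub_in_pairwise _ (mem (tval t))); last by apply/allP.
- move=> [i j] [k l] _ _; rewrite /column_le /= -!val_eqE /=; lia.
- move=> [i j] [k l] ct ct'; have := tn _ _ ct ct'.
  rewrite /nested /column_le /= -!val_eqE /=; lia.
Qed.

(** A nested pair is removed by the Pluecker relation, both terms of which have
    smaller spread and the same entries; without nested pairs, sorting the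
    columns gives a semistandard tableau. *)
Lemma straighten_strict l m s :
  strict_columns s -> size s = m ->
  (forall i, count_mem i (entries s) = l) -> semistandard_span l m (bracket_monomial s).
Proof.
have [N] := ubnP (spread s); elim: N s => // N IH s sN st sm sl.
case: (boolP (has (fun c => has (nested c) s) s)) => [/hasP[c cs /hasP[c' c's cc']]|].
  have ps : perm_eq s [:: c, c' & rem c' (rem c s)].
    rewrite (permPl (perm_to_rem cs)) perm_cons perm_to_rem //.
    move: c's; rewrite (perm_mem (perm_to_rem cs)) inE => /orP[/eqP E|//].
    by move: cc'; rewrite E /nested ltnn.
  move: c c' {cs c's} cc' ps => [i l'] [j k]; set r := rem _ _ => cc' ps.
  have mE : bracket_monomial s = bracket_monomial [:: (i, k), (j, l') & r]
      - bracket_monomial [:: (i, j), (k, l') & r].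
    rewrite /bracket_monomial (perm_big _ ps) /= !big_cons !mulrA (pbracket_plucker i j k l').
    exact: mulrBl.
  have := perm_all (fun c => c.1 < c.2)%N ps.
  rewrite -/(strict_columns s) st => /esym/= /and3P[/= il jk rst].
  have sE : spread s = ((l' - i) ^ 2 + ((k - j) ^ 2 + spread r))%N.
    by rewrite /spread (perm_big _ ps) /= !big_cons.
  have eE := perm_entries ps.
  move/andP: cc' => [/= ij kl].
  rewrite mE -scaleN1r; apply: semistandard_spanD; last apply: semistandard_spanZ; apply: IH.
  + by rewrite /spread !big_cons -/(spread r) /=; nia.
  + by rewrite /strict_columns /=; apply/and3P; split => //; lia.
  + by rewrite -sm (perm_size ps).
  + by move=> u; rewrite -(sl u) (permP eE) /entries /= !count_cat /=; lia.
  + by rewrite /spread !big_cons -/(spread r) /=; nia.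
  + by rewrite /strict_columns /=; apply/and3P; split => //; lia.
  + by rewrite -sm (perm_size ps).
  + by move=> u; rewrite -(sl u) (permP eE) /entries /= !count_cat /=; lia.
move=> /hasPn sn.
have size_t : size (sort column_le s) == m by rewrite size_sort sm.
pose t : tableau n m := Tuple size_t.
have ps : perm_eq (tval t) s by rewrite perm_sort.
have -> : bracket_monomial s = tableau_poly K t.
  by rewrite tableau_poly_seq /bracket_monomial (perm_big _ ps).
apply: semistandard_span_tableau.
  apply: sorted_unnested_semistandard.
  - by rewrite /strict_columns (perm_all _ ps).
  - exact/sort_sorted/column_le_total.
  - move=> c c'; rewrite !(perm_mem ps) => cs c's.
    by have /hasPn/(_ c' c's) := sn c cs.
by apply/forallP => i; rewrite -(sl i); apply/eqP/permP/perm_entries.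
Qed.

Lemma straighten l m (t : tableau n m) :
  equicontent l t -> semistandard_span l m (tableau_poly K t).
Proof.
move=> /forallP tl; rewrite tableau_poly_seq.
have [->|[e [s [-> s_strict ps ss]]]] := bracket_monomial_orient t; first exact: semistandard_span0.
apply: semistandard_spanZ; apply: straighten_strict => //; first by rewrite ss size_tuple.
by move=> i; rewrite (permP ps); apply/eqP/tl.
Qed.

Lemma graded_piece_span k p : graded_piece k p -> semistandard_span k (k * n./2) p.
Proof.
move=> [a ->]; apply: (big_ind (semistandard_span k (k * n./2))).
- exact: semistandard_span0.
- exact: semistandard_spanD.
- by move=> t tk; apply/semistandard_spanZ/straighten.
Qed.

Definition top_count m (t : tableau n m) (i : 'I_n) := count_mem i (top_row t).

Lemma equicontent_bottom l m (t : tableau n m) i :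
  equicontent l t -> count_mem i (bottom_row t) = (l - top_count t i)%N.
Proof.
by move=> /forallP /(_ i) /eqP; rewrite count_cat /top_count => <-; rewrite addKn.
Qed.

Lemma top_count_le l m (t : tableau n m) i :
  equicontent l t -> (top_count t i <= l)%N.
Proof.
by move=> /forallP /(_ i) /eqP; rewrite count_cat /top_count => <-; rewrite leq_addr.
Qed.

(** The top row is sorted, hence known from its counts; the counts of the bottom
    row are the complements to l. *)
Lemma semistandard_inj l m (t u : tableau n m) :
  semistandard t -> equicontent l t -> semistandard u -> equicontent l u ->
  (forall i, top_count t i = top_count u i) -> t = u.
Proof.
move=> /and3P[_ tt tb] tl /and3P[_ ut ub] ul tu.
have sort_inj (r r' : seq 'I_n) : sorted leq (map val r) -> sorted leq (map val r') ->
    (forall i, count_mem i r = count_mem i r') -> r = r'.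
  move=> sr sr' rr'; apply: (inj_map val_inj).
  apply: (sorted_eq leq_trans anti_leq) => //; apply: perm_map.
  by apply/allP => i _ /=; rewrite rr'.
have E1 : top_row t = top_row u by apply: sort_inj.
have E2 : bottom_row t = bottom_row u.
  by apply: sort_inj => // i; rewrite !(equicontent_bottom i tl, equicontent_bottom i ul) tu.
by apply: val_inj; rewrite /= -(zip_unzip t) -(zip_unzip u) -/(top_row _) -/(bottom_row _) E1 E2.
Qed.

(** A column whose bottom entry is at most i has its top entry below i. *)
Lemma ballot m (t : tableau n m) i : semistandard t ->
  (count (fun j : 'I_n => j <= i)%N (bottom_row t) <=
   count (fun j : 'I_n => j < i)%N (top_row t))%N.
Proof.
move=> /and3P[+ _ _]; rewrite /top_row /bottom_row !count_map.
elim: (tval t) => //= c s IH /andP[cc /IH]; lia.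
Qed.
End Straightening.

(** * The number of semistandard tableaux *)
Section Counting.
Variable n : nat.

Lemma sum_count_mem (r : seq 'I_n) : \sum_i count_mem i r = size r.
Proof.
elim: r => [|x r IH] /=; first by rewrite big1.
by rewrite big_split /= IH (bigD1 x) //= eqxx big1 // => i /negPf; rewrite eq_sym => ->.
Qed.

Lemma top_count0 l m (t : tableau n m) (i : 'I_n) :
  semistandard t -> equicontent l t -> i = 0 :> nat -> top_count t i = l.
Proof.
move=> ts tl i0; have := ballot i ts.
have -> : count (fun j : 'I_n => j < i) (top_row t) = 0.
  by apply/eqP; rewrite -leqn0 leqNgt -has_count -all_predC i0; apply/allP.
rewrite i0; have : count_mem i (bottom_row t) <= count (fun j : 'I_n => j <= 0) (bottom_row t).
  by apply: sub_count => j /eqP ->; rewrite i0.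
have := top_count_le i tl; rewrite (equicontent_bottom i tl); lia.
Qed.

Lemma top_count_max m (t : tableau n m) (i : 'I_n) :
  semistandard t -> i = n.-1 :> nat -> top_count t i = 0.
Proof.
move=> /and3P[/allP ts _ _] im; apply/count_memPn/mapP => -[c /ts + ci].
by rewrite /= -ci im; case: (c.2) => x /= x_lt; lia.
Qed.

Lemma sum_top_count m (t : tableau n m) : \sum_i top_count t i = m.
Proof. by rewrite sum_count_mem size_map size_tuple. Qed.

Definition semistandard_set l m : {set tableau n m} := [set t | semistandard t && equicontent l t].

(** Of the n counts in the top row three are forced: the least symbol occurs
    only there, the largest never, and the total of the counts is m. *)
Lemma card_semistandard l m : #|semistandard_set l m| <= l.+1 ^ (n - 3).
Proof.
pose inner (x : 'I_(n - 3)) (H : x.+1 < n) := Ordinal H.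
have inner_lt (x : 'I_(n - 3)) : x.+1 < n by have := ltn_ord x; lia.
pose F (t : tableau n m) : {ffun 'I_(n - 3) -> 'I_l.+1} :=
  [ffun x => inord (top_count t (inner x (inner_lt x)))].
suff F_inj : {in semistandard_set l m &, injective F}.
  by rewrite -(card_in_imset F_inj) (leq_trans (max_card _)) // card_ffun !card_ord.
move=> t u; rewrite !inE => /andP[ts tl] /andP[us ul] tu.
apply: (semistandard_inj ts tl us ul).
have E (i : 'I_n) : i.+2 != n -> top_count t i = top_count u i.
  move=> i2; case: (posnP i) => [i0|i0]; first by rewrite !(top_count0 (l := l)).
  have := ltn_ord i; rewrite leq_eqVlt => /orP[/eqP im|im].
    by rewrite !(top_count_max _ (congr1 predn im)).
  have x_lt : i.-1 < n - 3 by lia.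
  have /ffunP/(_ (Ordinal x_lt)) := tu; rewrite !ffunE => /(congr1 val).
  have -> : inner _ (inner_lt (Ordinal x_lt)) = i by apply: val_inj => /=; lia.
  by rewrite /= !inordK // ltnS (top_count_le i (l := l)).
move=> i; have [i2|] := eqVneq i.+2 n; last exact: E.
have := etrans (sum_top_count t) (esym (sum_top_count u)).
rewrite (bigD1 i) //= [in RHS](bigD1 i) //=.
rewrite (eq_bigr (top_count u)) => [/eqP|j ji]; first by rewrite eqn_add2r => /eqP.
by apply: E; apply: contra ji => /eqP j2; apply/eqP/val_inj => /=; lia.
Qed.
End Counting.

(** Motzkin paths from height h down to height 0 without level step at height 0.
    A step is coded by the number of times a symbol occurs in the top row of a
    tableau of content (2, ..., 2): 2 is a step up, 1 a level step, 0 a step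
    down. *)
Fixpoint riordan_paths n h : seq (seq nat) :=
  if n is n'.+1 then
    map (cons 2) (riordan_paths n' h.+1) ++
    (if h is h'.+1 then map (cons 1) (riordan_paths n' h) ++ map (cons 0) (riordan_paths n' h') else [::])
  else if h is 0 then [:: [::]] else [::].

Fixpoint riordan n h : nat :=
  if n is n'.+1 then
    riordan n' h.+1 + (if h is h'.+1 then riordan n' h + riordan n' h' else 0)
  else h == 0.

Lemma size_riordan_paths n h : size (riordan_paths n h) = riordan n h.
Proof.
elim: n h => [[]|n IH [|h]] //=; rewrite size_cat size_map IH //=.
by rewrite size_cat !size_map !IH.
Qed.

Lemma riordan_gt n h : n < h -> riordan n h = 0.
Proof. by elim: n h => [[]|n IH [|h]] //= nh; rewrite !IH //; lia. Qed.

(** After i steps the path s has height h + sumn (take i s) - i, so the second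
    hypothesis, which is the ballot inequality for tableaux, forces the height to
    be positive before a level step or a step down. *)
Lemma mem_riordan_paths h s :
  (forall i, i < size s -> nth 0 s i <= 2) ->
  (forall i, i < size s -> (i.+1).*2 <= sumn (take i s) + sumn (take i.+1 s) + h.*2) ->
  sumn s + h = size s -> s \in riordan_paths (size s) h.
Proof.
elim: s h => [|a s IH] h s2 sb st; first by case: h st {sb}.
have a2 : a <= 2 := s2 0 isT.
have ab := sb 0 isT; rewrite /= take0 /= in ab st.
have sb' i : i < size s -> (i.+2).*2 <= a + sumn (take i s) + (a + sumn (take i.+1 s)) + h.*2.
  exact: (sb i.+1).
rewrite /= mem_cat; case: a a2 => [|[|[|]]] // _ in s2 sb ab sb' st *.
- case: h => [|h] in sb ab sb' st *; first by lia.
  rewrite mem_cat (map_f (cons 0)) ?orbT //; apply: IH; [exact: (fun i => s2 i.+1)| |lia].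
  by move=> i /sb'; lia.
- case: h => [|h] in sb ab sb' st *; first by lia.
  rewrite mem_cat (map_f (cons 1)) ?orbT //; apply: IH; [exact: (fun i => s2 i.+1)| |lia].
  by move=> i /sb'; lia.
- rewrite (map_f (cons 2)) //; apply: IH; [exact: (fun i => s2 i.+1)| |lia].
  by move=> i /sb'; lia.
Qed.

(** The step recursion has the eigenvector 2h + 1 for the eigenvalue 3, also at
    the boundary: (2h-1) + (2h+1) + (2h+3) = 3(2h+1), and 3 = 3 * 1 for h = 0.
    Hence a bound by a multiple of 2h + 1 propagates. It starts at
    eight steps, where it is an equality for h = 0. *)
Lemma riordan_le n h : riordan (8 + n) h <= 91 * 3 ^ n * h.*2.+1.
Proof.
elim: n h => [|n IH] h.
  rewrite addn0 expn0 muln1; case: (leqP h 8) => [|/riordan_gt-> //].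
  by do 9 (case: h => [|h]; first by vm_compute).
rewrite addnS; move: (8 + n) IH => k IH /=; have h1 := IH h.+1; have h0 := IH h.
by case: h h0 h1 => [|h] h0 h1; [|have hm := IH h]; rewrite expnS; nia.
Qed.

(** The ratio (4k+2)/(k+2) of consecutive Catalan numbers is at least 3 as soon
    as k >= 4. *)
Lemma catalan_ge m : 14 * 3 ^ m <= catalan (4 + m).
Proof.
rewrite /catalan leq_divRL ?muln_gt0 ?fact_gt0 //.
elim: m => [|m IH]; first by vm_compute.
have -> : 2 * (4 + m.+1) = (2 * (4 + m)).+2 by lia.
have -> : 4 + m.+1 = (4 + m).+1 by lia.
move: IH; set k := 4 + m; have : 4 <= k by rewrite leq_addr.
rewrite expnS (factS (2 * k).+1) (factS (2 * k)) (factS k.+1).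
rewrite {2}(factS k).
move: (k.+1`!) (k`!) ((2 * k)`!) (3 ^ m) => a b c d k4 IH.

nia.
Qed.

(** * An upper bound for the Krull dimension of the invariant ring *)
Section KrullUpperBound.
Local Open Scope ring_scope.
Variables (n : nat) (K : fieldType).
Local Notation R := (invariant_ring n K).

Lemma semistandard_spanE l m (p : {mpoly K[n + n]}) : semistandard_span l m p ->
  exists a : 'I_#|semistandard_set n l m| -> K, p = \sum_j a j *: tableau_poly K (enum_val j).
Proof.
move=> [a ->]; exists (fun j => a (enum_val j)).
transitivity (\sum_(t in semistandard_set n l m) a t *: tableau_poly K t).
  by apply: eq_bigl => t; rewrite inE.
exact: big_enum_val.
Qed.

Definition filtered d (p : {mpoly K[n + n]}) : Prop :=
  exists2 r : nat -> {mpoly K[n + n]},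
    forall k, graded_piece k (r k) & p = \sum_(k < d.+1) r k.

Lemma filteredD d p q : filtered d p -> filtered d q -> filtered d (p + q).
Proof.
move=> [r rP ->] [s sP ->]; exists (fun k => r k + s k).
  by move=> k; apply: graded_pieceD.
by rewrite big_split.
Qed.

Lemma filtered_graded d k p : (k <= d)%N -> graded_piece k p -> filtered d p.
Proof.
move=> kd pk; exists (fun i => if i == k then p else 0).
  by move=> i; case: eqP => [->|_] //; apply: graded_piece0.
rewrite (bigD1 (Ordinal (n := d.+1) (m := k) kd)) //= eqxx big1 ?addr0 // => i.
by rewrite -val_eqE => /negPf ->.
Qed.

Lemma filtered_sum d (I : Type) (s : seq I) (F : I -> {mpoly K[n + n]}) :
  (forall i, filtered d (F i)) -> filtered d (\sum_(i <- s) F i).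
Proof.
move=> FP; apply: (big_ind (filtered d)) => //.
- exact: filtered_graded (leq0n d) (graded_piece0 _ _ _).
- exact: filteredD.
Qed.

Lemma filtered_le d e p : (d <= e)%N -> filtered d p -> filtered e p.
Proof.
move=> de [r rP ->]; apply: filtered_sum => k.
by apply: filtered_graded (rP k); apply: leq_trans de; rewrite -ltnS.
Qed.

Lemma filteredM d e p q : filtered d p -> filtered e q -> filtered (d + e) (p * q).
Proof.
move=> [r rP ->] [s sP ->]; rewrite mulr_suml.
apply: filtered_sum => k; rewrite mulr_sumr; apply: filtered_sum => l.
apply: filtered_graded (graded_pieceM (rP k) (sP l)).
by apply: leq_add; rewrite -ltnS.
Qed.

Lemma filteredX d p k : filtered d p -> filtered (k * d) (p ^+ k).
Proof.
move=> pd; elim: k => [|k IH]; first exact: filtered_graded (graded_piece1 _ _).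
by rewrite exprS mulSn; apply: filteredM.
Qed.

Lemma filtered_prod d m (F : 'I_m -> {mpoly K[n + n]}) :
  (forall i, filtered d (F i)) -> filtered (m * d) (\prod_i F i).
Proof.
elim: m F => [|m IH] F FP.
  by rewrite big_ord0; apply: filtered_graded (graded_piece1 _ _).
by rewrite big_ord_recl mulSn; apply: filteredM => //; apply: IH.
Qed.

Lemma invariant_filtered (a : R) : exists d, filtered d (inv_val a).
Proof.
case: a => p /= /asboolP[m [r [rP ->]]]; exists m; apply: filtered_sum => k.
exact: filtered_graded (ltnW (ltn_ord k)) (rP k).
Qed.

Lemma filtered_span d p : filtered d p ->
  exists a : {k : 'I_d.+1 & 'I_#|semistandard_set n k (k * n./2)|} -> K,
    p = \sum_j a j *: tableau_poly K (enum_val (tagged j)).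
Proof.
move=> [r rP ->].
have rk (k : 'I_d.+1) :
    exists a : 'I_#|semistandard_set n k (k * n./2)| -> K,
      r k = \sum_j a j *: tableau_poly K (enum_val j).
  exact/semistandard_spanE/graded_piece_span.
pose a (k : 'I_d.+1) := projT1 (cid (rk k)).
have aP (k : 'I_d.+1) : r k = \sum_j a k j *: tableau_poly K (enum_val j) := projT2 (cid (rk k)).
exists (fun j => a (tag j) (tagged j)).
transitivity (\sum_k \sum_j a k j *: tableau_poly K (enum_val j)).
  by apply: eq_bigr => k _; apply: aP.
rewrite (sig_big_dep xpredT (fun=> xpredT)) /=.
by [].
Qed.

Lemma card_filtered d :
  (#|{: {k : 'I_d.+1 & 'I_#|semistandard_set n k (k * n./2)|}}| <= d.+1 ^ (n - 3).+1)%N.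
Proof.
rewrite card_tagged sumnE big_map big_enum expnS.
rewrite -[X in (_ <= X * _)%N]card_ord -sum_nat_const.
apply: leq_sum => k _; rewrite card_ord (leq_trans (card_semistandard _ _ _)) //.
by case: (n - 3)%N => [|e] //; rewrite leq_exp2r.
Qed.

Fact scalar_invariant (c : K) : c%:MP \in @invariant_ring_pred n K.
Proof.
rewrite -[c%:MP]mulr1 mul_mpolyC.
exact: graded_piece_invariant (graded_pieceZ c (graded_piece1 n K)).
Qed.

Definition scalar (c : K) : R := InvariantRing (scalar_invariant c).

Fact scalar_zmod : zmod_morphism scalar.
Proof. by move=> c e; apply: val_inj; rewrite /= mpolyCB. Qed.

Fact scalar_monoid : monoid_morphism scalar.
Proof. by split=> [|c e]; apply: val_inj; rewrite /= ?mpolyCM. Qed.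

HB.instance Definition _ := GRing.isZmodMorphism.Build K R scalar scalar_zmod.
HB.instance Definition _ := GRing.isMonoidMorphism.Build K R scalar scalar_monoid.

(** Put D = n - 2 for n >= 3 and D = 1 otherwise: the (M+1)^(D+1) monomials in D + 1 elements
    with exponents at most M have degree O(M), hence lie in a space of dimension
    O(M^D), and are linearly dependent once M is large. *)
Lemma krull_dim_invariant_ring_le e :
  has_prime_chain R e -> (e <= (n - 3).+1)%N.
Proof.
apply: (krull_dim_le_trdeg (iota := scalar)) => x.
set D := (n - 3).+1.
have /choice[b bP] (i : 'I_D.+1) : exists d, filtered d (inv_val (x i)).
  exact: invariant_filtered.
pose B := \sum_i b i.
have xB i : filtered B (inv_val (x i)).
  by apply: filtered_le (bP i); rewrite /B (bigD1 i) //= leq_addr.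
(* For this M, (D.+1 * (M * B)).+1 ^ D <= M * M.+1 ^ D < M.+1 ^ D.+1. *)
pose M := ((D.+1 * B).+1 ^ D)%N; exists M.+1.
pose d := (D.+1 * (M * B))%N.
pose v (t : D.+1.-tuple 'I_M.+1) := \prod_i inv_val (x i) ^+ tnth t i.
have [|t|c cn0 c0] := @linear_dependence _ _ _ _ v
    (fun j : {k : 'I_d.+1 & 'I_#|semistandard_set n k (k * n./2)|} =>
       tableau_poly K (enum_val (tagged j))).
- rewrite (leq_ltn_trans (card_filtered d)) // card_tuple card_ord -/D.
  rewrite [in X in (_ < X)%N]expnS.
  apply: (@leq_ltn_trans (M * M.+1 ^ D)%N); last by rewrite ltn_pmul2r ?expn_gt0.
  by rewrite -expnMn leq_exp2r // /d; nia.
- apply: filtered_span; apply: filtered_prod => i.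
  apply: filtered_le (filteredX (tnth t i) (xB i)).
  by rewrite leq_mul2r -ltnS ltn_ord orbT.
exists c; split => //; apply: val_inj; rewrite [LHS](raddf_sum \val) -[RHS]c0.
apply: eq_bigr => t _; rewrite [LHS](rmorphM \val) (rmorph_prod \val) /= mul_mpolyC; congr (_ *: _).
by apply: eq_bigr => i _; rewrite [LHS](rmorphXn \val).
Qed.
End KrullUpperBound.

(** * Configurations of points and chains of primes *)
Section Points.
Local Open Scope ring_scope.
Variables (n : nat).
Local Notation column := ('I_n * 'I_n)%type.

(** The point of affine 2n-space that stands for n vectors (x i, y i). *)
Definition config (A : Type) (x y : 'I_n -> A) (k : 'I_(n + n)) : A :=
  match split k with inl i => x i | inr i => y i end.

Definition tableau_value (A : comNzRingType) (x y : 'I_n -> A) (s : seq column) : A :=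
  \prod_(c <- s) (x c.1 * y c.2 - x c.2 * y c.1).

Lemma configl A (x y : 'I_n -> A) i : config x y (lshift n i) = x i.
Proof. by rewrite /config -[lshift n i]/(unsplit (inl _ i)) unsplitK. Qed.

Lemma configr A (x y : 'I_n -> A) i : config x y (rshift n i) = y i.
Proof. by rewrite /config -[rshift n i]/(unsplit (inr _ i)) unsplitK. Qed.

Variable K : numFieldType.
Local Notation R := (invariant_ring n K).

Lemma tableau_poly_value m (t : tableau n m) (x y : 'I_n -> K) :
  (tableau_poly K t).@[config x y] = tableau_value x y t.
Proof.
rewrite rmorph_prod; apply: eq_bigr => c _.
by rewrite /= mevalB !mevalM !mevalXU !configl !configr.
Qed.

Lemma config_eta A (v : 'I_(n + n) -> A) :
  v =1 config (fun i => v (lshift n i)) (fun i => v (rshift n i)).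
Proof. by move=> k; rewrite -(splitK k); case: (split k) => i; rewrite ?configl ?configr. Qed.

(** The invariants that vanish on a family of configurations parametrised by
    affine m-space. The parametrisation makes this the kernel of a morphism to a
    polynomial ring, hence a prime ideal. *)
Definition param_ideal m (x y : 'I_n -> {mpoly K[m]}) : {pred R} :=
  fun a => inv_val a \mPo mktuple (config x y) == 0.

Lemma param_idealP m (x y : 'I_n -> {mpoly K[m]}) (a : R) :
  reflect (forall v, (inv_val a).@[config (fun i => (x i).@[v]) (fun i => (y i).@[v])] = 0)
    (a \in param_ideal x y).
Proof.
have E v : (inv_val a \mPo mktuple (config x y)).@[v] =
    (inv_val a).@[config (fun i => (x i).@[v]) (fun i => (y i).@[v])].
  rewrite comp_mpoly_meval; apply: meval_eq => k; rewrite tnth_mktuple.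
  by rewrite /config; case: (split k).
apply: (iffP eqP) => [a0 v|a0]; first by rewrite -E a0 meval0.
by apply: mpoly_vanish => v; rewrite E.
Qed.

Lemma param_ideal_prime m (x y : 'I_n -> {mpoly K[m]}) : prime_ideal (param_ideal x y).
Proof.
split; first split.
- by apply/eqP; rewrite [LHS]comp_mpoly0.
- by rewrite unfold_in [inv_val _ \mPo _]comp_mpoly1 oner_eq0.
- move=> a u v /eqP u0 /eqP v0; apply/eqP.
  by rewrite comp_mpolyD rmorphM /= u0 v0 mulr0 addr0.
- move=> u v; rewrite !unfold_in rmorphM mulf_eq0; exact.
Qed.

Lemma tableau_poly_graded (t : tableau n n./2) :
  equicontent 1 t -> graded_piece 1 (tableau_poly K t).
Proof.
move=> t1; pose u : tableau n (1 * n./2) := tcast (esym (mul1n _)) t.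
have uE : tval u = tval t by rewrite val_tcast.
have -> : tableau_poly K t = tableau_poly K u by rewrite /tableau_poly uE.
apply: graded_piece_tableau; move: t1.
by rewrite /equicontent /top_row /bottom_row uE.
Qed.

Fact tableau_invariant_subproof (t : tableau n n./2) :
  (if equicontent 1 t then tableau_poly K t else 0) \in @invariant_ring_pred n K.
Proof.
case: ifP => t1; apply: (@graded_piece_invariant _ _ 1); last exact: graded_piece0.
exact: tableau_poly_graded.
Qed.

(** The value 0 for other contents only serves to make the function total. *)
Definition tableau_invariant t : R := InvariantRing (tableau_invariant_subproof t).

Lemma tableau_invariantE t :
  equicontent 1 t -> inv_val (tableau_invariant t) = tableau_poly K t.
Proof. by rewrite /= => ->. Qed.

(** The first hypothesis says that the family number i.+1 specialises the family
    number i, so that the ideals increase; the tableau t i shows that they do so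
    strictly. *)
Lemma has_prime_chain_param d m (x y : nat -> 'I_n -> {mpoly K[m]})
    (t : nat -> tableau n n./2) (w : nat -> 'I_m -> K) :
  (forall i (v : 'I_m -> K), (i < d)%N -> exists u : 'I_m -> K,
     (forall j, (x i.+1 j).@[v] = (x i j).@[u]) /\
     (forall j, (y i.+1 j).@[v] = (y i j).@[u])) ->
  (forall i, (i < d)%N -> equicontent 1 (t i)) ->
  (forall i, (i < d)%N ->
     tableau_value (fun j => (x i j).@[w i]) (fun j => (y i j).@[w i]) (t i) != 0) ->
  (forall i v, (i < d)%N ->
     tableau_value (fun j => (x i.+1 j).@[v]) (fun j => (y i.+1 j).@[v]) (t i) = 0) ->
  has_prime_chain R d.
Proof.
move=> xy_sub t1 t_ne t_eq; exists (fun i => param_ideal (x i) (y i)); split.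
  by move=> i _; apply: param_ideal_prime.
move=> i id; split.
  move=> a /param_idealP a0; apply/param_idealP => v.
  have [u [xu yu]] := xy_sub i v id; rewrite -(a0 u); apply: meval_eq => k.
  by rewrite /config; case: (split k).
exists (tableau_invariant (t i)).
  apply/param_idealP => v; rewrite tableau_invariantE ?t1 //.
  by rewrite tableau_poly_value t_eq.
apply/negP => /param_idealP /(_ (w i)); rewrite tableau_invariantE ?t1 //.
by rewrite tableau_poly_value => /eqP; apply/negP/t_ne.
Qed.

(** * Linear independence of the basis tableaux *)
Definition indicator (A : pred 'I_n) (i : 'I_n) : K := (A i)%:R.

(** When the symbols in A are placed at the vector (1, 0) and the others at
    (0, 1), only the brackets between A and its complement survive. *)
Lemma separating_value (A : pred 'I_n) (s : seq column) :
  tableau_value (indicator A) (indicator (predC A)) s != 0 ->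
  all (fun c => A c.1 != A c.2) s.
Proof.
rewrite /tableau_value prodf_seq_neq0; apply: sub_all => c /=.
by apply: contra => /eqP E; rewrite /indicator /= E subrr.
Qed.

Lemma separating_top (A : pred 'I_n) (s : seq column) :
  all (fun c => A c.1 && ~~ A c.2) s ->
  tableau_value (indicator A) (indicator (predC A)) s = 1.
Proof.
elim: s => [|c s IH] /=; first by rewrite /tableau_value big_nil.
case/andP => /andP[c1 c2] /IH; rewrite /tableau_value big_cons => ->.
by rewrite /indicator /= c1 (negPf c2) /= mulr1 mulr0 subr0 mulr1.
Qed.

Definition top_pred (t : tableau n n./2) : pred 'I_n := fun i => i \in top_row t.

Definition top_sum (s : seq column) : nat := (\sum_(c <- s) c.1)%N.

(** The total of the entries in A. It depends only on the multiset of entries, so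
    it is the same for all tableaux of content (1, ..., 1); comparing it with
    top_sum is what makes the evaluations triangular. *)
Definition weight (A : pred 'I_n) (s : seq column) : nat :=
  (\sum_(i <- entries s) A i * i)%N.

Lemma weight_perm A s s' : perm_eq (entries s) (entries s') -> weight A s = weight A s'.
Proof. exact: perm_big. Qed.

Lemma weightE A s : weight A s = (\sum_(c <- s) (A c.1 * c.1 + A c.2 * c.2))%N.
Proof. by rewrite /weight /entries big_cat !big_map [RHS]big_split. Qed.

Lemma equicontent1_column (t : tableau n n./2) i :
  equicontent 1 t -> (i \in bottom_row t) = (i \notin top_row t).
Proof.
move=> /forallP /(_ i) /eqP; rewrite count_cat.
rewrite -!has_pred1 !has_count.
by case: (count_mem i _) (count_mem i _) => [|[]] [|[]].
Qed.

Lemma top_pred_columns (t : tableau n n./2) :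
  equicontent 1 t -> all (fun c => top_pred t c.1 && ~~ top_pred t c.2) t.
Proof.
move=> t1; apply/allP => c ct; rewrite /top_pred -(equicontent1_column _ t1).
by rewrite !map_f.
Qed.

Lemma weight_top (t : tableau n n./2) :
  equicontent 1 t -> weight (top_pred t) t = top_sum t.
Proof.
move=> /top_pred_columns /allP tc; rewrite weightE; apply: eq_big_seq => c /tc.
by case/andP => -> /negPf ->; rewrite mul1n addn0.
Qed.

Lemma top_sum_weight A s : strict_columns s -> all (fun c => A c.1 != A c.2) s ->
  (top_sum s <= weight A s)%N /\
  (top_sum s = weight A s -> all (fun c => A c.1 && ~~ A c.2) s).
Proof.
rewrite weightE /top_sum /strict_columns; elim: s => [|c s IH]; first by rewrite !big_nil.
move=> /= /andP[c12 /IH {}IH] /andP[cA /IH[le eq]]; rewrite !big_cons.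
case: (A c.1) (A c.2) cA => [] [] // _; rewrite ?mul1n ?mul0n ?addn0 ?add0n /=.
  by rewrite leq_add2l; split=> // /addnI.
by split; [apply: leq_add => //; apply: ltnW | move=> E; move: c12; rewrite ltnNge; lia].
Qed.

(** Place the top row of t at (1, 0) and its bottom row at (0, 1). If u does not
    vanish there, each column of u contains one entry from the top row of t, and
    the total of these entries is top_sum t. As each is at least the top entry of
    its column, top_sum u <= top_sum t; equality forces the top rows of t and u
    to coincide. *)
Lemma basis_triangular (t u : tableau n n./2) :
  t \in basis_tableaux n -> u \in basis_tableaux n -> (top_sum t <= top_sum u)%N ->
  tableau_value (indicator (top_pred t)) (indicator (predC (top_pred t))) u != 0 -> u = t.
Proof.
rewrite !inE => /andP[ts t1] /andP[us u1] tu /separating_value sep.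
have u_strict : strict_columns u by case/and3P: us.
have [le eq] := top_sum_weight u_strict sep.
have ent : perm_eq (entries t) (entries u).
  by apply/allP => i _ /=; move/forallP: t1 => /(_ i) /eqP ->; move/forallP: u1 => /(_ i) /eqP ->.
have wE : weight (top_pred t) u = top_sum t by rewrite -(weight_perm _ ent) weight_top.
have /allP uA : all (fun c => top_pred t c.1 && ~~ top_pred t c.2) u.
  by apply: eq; apply/eqP; rewrite eqn_leq le wE tu.
apply: (semistandard_inj us u1 ts t1) => i.
have topE : (i \in top_row u) = (i \in top_row t).
  case iu: (i \in top_row u); last first.
    move/negbT: iu; rewrite -(equicontent1_column _ u1) => /mapP[c /uA /andP[_ c2] ->].
    by apply/esym/negbTE.
  by case/mapP: iu => c /uA /andP[c1 _] ->; apply/esym.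
have cnt (v : tableau n n./2) : equicontent 1 v -> top_count v i = (i \in top_row v).
  move=> v1; have := top_count_le i v1; rewrite -has_pred1 has_count /top_count.
  by case: (count _ _) => [|[]].
by rewrite !cnt ?topE.
Qed.

Lemma basis_tableau_neq0 (t : tableau n n./2) : t \in basis_tableaux n ->
  tableau_value (indicator (top_pred t)) (indicator (predC (top_pred t))) t = 1.
Proof. by rewrite inE => /andP[_ t1]; apply/separating_top/top_pred_columns. Qed.

Lemma basis_independent (c : tableau n n./2 -> K) :
  \sum_(t in basis_tableaux n) c t *: tableau_poly K t = 0 ->
  forall t, t \in basis_tableaux n -> c t = 0.
Proof.
move=> c0 t tB; apply/eqP; apply: contraT => ct.
pose good u := (u \in basis_tableaux n) && (c u != 0).
have good_t : good t by rewrite /good tB.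
case: (arg_minnP (P := good) (fun u => top_sum u) good_t) => t0 /andP[t0B ct0] t0min.
have := congr1 (meval (config (indicator (top_pred t0)) (indicator (predC (top_pred t0))))) c0.
rewrite meval0 raddf_sum (bigD1 t0) //= mevalZ tableau_poly_value basis_tableau_neq0 //.
rewrite mulr1 big1 ?addr0 => [E|u /andP[uB ut0]]; first by rewrite E eqxx in ct0.
rewrite mevalZ tableau_poly_value.
have [->|cu] := eqVneq (c u) 0; first by rewrite mul0r.
apply/eqP; rewrite mulf_eq0; apply/orP; right; apply: contraR ut0.
by move/(basis_triangular t0B uB) => /(_ _)/eqP -> //; apply: t0min; rewrite /good uB.
Qed.
End Points.

(** * Semistandard tableaux of content (2, ..., 2) *)
Section ContentTwo.
Variable n : nat.

Lemma count_ltS (r : seq 'I_n) (i : 'I_n) :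
  count (fun j : 'I_n => j < i.+1) r = count (fun j : 'I_n => j < i) r + count_mem i r.
Proof.
elim: r => //= j r ->; have -> : (j < i.+1) = (j < i) + (j == i) :> nat.
  by rewrite ltnS leq_eqVlt -val_eqE; case: ltngtP.
by rewrite addnACA.
Qed.

Lemma count_lt_entries l m (t : tableau n m) i : equicontent l t -> i <= n ->
  count (fun j : 'I_n => j < i) (entries t) = l * i.
Proof.
move=> /forallP tl; elim: i => [|i IH] ile.
  by rewrite muln0; apply/eqP; rewrite -leqn0 leqNgt -has_count -all_predC; apply/allP.
rewrite (count_ltS _ (Ordinal ile)) /= IH ?(ltnW ile) // mulnS addnC; congr (_ + _).
exact/eqP/(tl (Ordinal ile)).
Qed.

Definition top_counts m (t : tableau n m) : seq nat := map (top_count t) (enum 'I_n).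

Lemma size_top_counts m (t : tableau n m) : size (top_counts t) = n.
Proof. by rewrite size_map size_enum_ord. Qed.

Lemma nth_top_counts m (t : tableau n m) (i : 'I_n) : nth 0 (top_counts t) i = top_count t i.
Proof. by rewrite (nth_map i) ?size_enum_ord // nth_ord_enum. Qed.

Lemma sumn_take_top_counts m (t : tableau n m) i : i <= n ->
  sumn (take i (top_counts t)) = count (fun j : 'I_n => j < i) (top_row t).
Proof.
elim: i => [|i IH] ile.
  by rewrite take0; apply/esym/eqP; rewrite -leqn0 leqNgt -has_count -all_predC; apply/allP.
rewrite (take_nth 0) ?size_top_counts // sumn_rcons IH ?(ltnW ile) //.
by rewrite (count_ltS _ (Ordinal ile)) (nth_top_counts t (Ordinal ile)).
Qed.

(** Up to symbol i each symbol occurs twice, so the ballot inequality for the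
    bottom row is an inequality between prefix sums of the top counts. *)
Lemma top_counts_riordan (t : tableau n n) :
  semistandard t -> equicontent 2 t -> top_counts t \in riordan_paths n 0.
Proof.
move=> ts t2; rewrite -[X in riordan_paths X _](size_top_counts t).
apply: mem_riordan_paths; rewrite size_top_counts.
- by move=> i ile; rewrite (nth_top_counts t (Ordinal ile)) (top_count_le _ t2).
- move=> i ile; rewrite !sumn_take_top_counts ?(ltnW ile) //.
  have := ballot (Ordinal ile) ts; have := count_lt_entries t2 ile.
  rewrite count_cat -/(top_row t) -/(bottom_row t) /= => E B.
  by move: E; rewrite [X in _ + X](eq_count (a2 := fun j : 'I_n => j <= i)) //; lia.
rewrite addn0 -[X in sumn X]take_size size_top_counts sumn_take_top_counts //.
rewrite (eq_count (a2 := predT)); first by rewrite count_predT size_map size_tuple.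
by move=> j; rewrite /= ltn_ord.
Qed.

Lemma card_semistandard2 : #|semistandard_set n 2 n| <= riordan n 0.
Proof.
rewrite -size_riordan_paths cardE -(size_map (@top_counts n)); apply: uniq_leq_size.
  rewrite map_inj_in_uniq ?enum_uniq // => t u.
  rewrite !mem_enum !inE => /andP[ts tl] /andP[us ul] tu.
  apply: (semistandard_inj ts tl us ul) => i.
  by rewrite -!nth_top_counts tu.
by move=> s /mapP[t]; rewrite mem_enum inE => /andP[ts t2] ->; apply: top_counts_riordan.
Qed.
End ContentTwo.

(** * Too many quadrics for n at least 8 *)
Section NotCompleteIntersection.
Local Open Scope ring_scope.
Variables (K : numFieldType) (n N : nat) (T : N.+1.-tuple (tableau n n./2)).
Hypothesis T_basis : perm_eq T (enum (basis_tableaux n)).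

Lemma kempe_tuple_uniq : uniq T.
Proof. by rewrite (perm_uniq T_basis) enum_uniq. Qed.

Lemma mem_kempe_tuple t : (t \in T) = (t \in basis_tableaux n).
Proof. by rewrite (perm_mem T_basis) mem_enum. Qed.

Lemma tnth_basis i : tnth T i \in basis_tableaux n.
Proof. by rewrite -mem_kempe_tuple mem_tnth. Qed.

Lemma kempe_tnth i :
  tnth (map_tuple (@tableau_poly n K n./2) T) i = tableau_poly K (tnth T i).
Proof. exact: tnth_map. Qed.

Lemma kempe_mapX (m : 'X_{1..N.+1}) :
  kempe_map T 'X_[m] = \prod_i tableau_poly K (tnth T i) ^+ m i.
Proof. by rewrite [LHS]comp_mpolyX; apply: eq_bigr => i _; rewrite kempe_tnth. Qed.

Lemma kempe_map_graded k (p : {mpoly K[N.+1]}) :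
  p \is k.-homog -> graded_piece k (kempe_map T p).
Proof.
move=> /dhomogP pk; rewrite [p]mpolyE [kempe_map _ _]raddf_sum /= big_seq_cond.
apply: graded_piece_sum => m; rewrite andbT => /pk mk; have {}mk : mdeg m = k := mk.
rewrite comp_mpolyZ; apply: graded_pieceZ; rewrite -/(kempe_map T _) kempe_mapX -mk mdegE.
apply: (big_ind2 (fun a b => graded_piece a b)).
- exact: graded_piece1.
- by move=> a p1 b p2; apply: graded_pieceM.
- move=> i _; elim: (m i) => [|a IH]; first exact: graded_piece1.
  rewrite exprS -add1n; apply: graded_pieceM => //; apply: tableau_poly_graded.
  by have := tnth_basis i; rewrite inE => /andP[].
Qed.

Lemma linear_form (p : {mpoly K[N.+1]}) :
  p \is 1.-homog -> p = \sum_i p@_U_(i) *: 'X_i.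
Proof.
move=> p1; apply/mpolyP => m; rewrite raddf_sum /=.
under eq_bigr do rewrite mcoeffZ mcoeffX.
have [m1|m1] := eqVneq (mdeg m) 1%N; last first.
  rewrite (dhomog_nemf_coeff p1 m1) big1 // => i _.
  by case: eqP => [E|]; rewrite ?mulr0 //; rewrite -E mdeg1 eqxx in m1.
have /mdeg1P[i /eqP ->] := introT eqP m1.
rewrite (bigD1 i) //= eqxx mulr1 big1 ?addr0 // => j ji.
by case: eqP => [/mnmP/(_ i)|]; rewrite ?mulr0 // !mnm1E eqxx (negPf ji).
Qed.

Lemma kempe_ideal_low d (p : {mpoly K[N.+1]}) :
  p \is d.-homog -> kempe_ideal T p -> (d < 2)%N -> p = 0.
Proof.
rewrite /kempe_ideal; case: d => [|[|//]] ph p0 _.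
  have pE : p = (p@_0)%:MP.
    apply/mpolyP => m; rewrite mcoeffC; have [->|m0] := eqVneq m 0%MM.
      by rewrite mulr1.
    by rewrite mulr0 (dhomog_nemf_coeff ph) // mdeg_eq0.
  move: p0; rewrite pE /kempe_map comp_mpolyC => /eqP; rewrite mpolyC_eq0 => /eqP ->.
  by rewrite mpolyC0.
pose c t := \sum_(i | tnth T i == t) p@_U_(i).
have cT i : c (tnth T i) = p@_U_(i).
  by apply: big_pred1 => j; apply: (inj_eq (tuple_uniqP _ kempe_tuple_uniq)).
suff c0 : \sum_(t in basis_tableaux n) c t *: tableau_poly K t = 0.
  rewrite (linear_form ph) big1 // => i _.
  by rewrite -cT (basis_independent c0) ?scale0r ?tnth_basis.
rewrite -[RHS]p0 [in RHS](linear_form ph) [RHS]raddf_sum /= /c.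
under eq_bigr do rewrite scaler_suml.
rewrite (exchange_big_dep xpredT) //=; apply: eq_bigr => i _.
rewrite (big_pred1 (tnth T i)) => [|t].
  by rewrite comp_mpolyZ comp_mpolyXU -tnth_nth kempe_tnth.
by rewrite /= [_ == t]eq_sym; case: eqP => [->|]; rewrite ?tnth_basis ?andbF.
Qed.

(** In degree 2, a multiple of a form of degree at least 2 only sees the constant
    term of the factor. *)
Lemma quadric_coeff d (q f : {mpoly K[N.+1]}) m :
  f \is d.-homog -> (2 <= d)%N -> mdeg m = 2%N -> (q * f)@_m = q@_0 * f@_m.
Proof.
move=> fd d2 m2; rewrite {1}[q]mpolyE mulr_suml raddf_sum /=.
have E (u : 'X_{1..N.+1}) : ((q@_u *: 'X_[u]) * f)@_m = if u == 0%MM then q@_0 * f@_m else 0.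
  rewrite -scalerAl mcoeffZ; case: eqVneq => [->|u0].
    by rewrite mpolyX0 mul1r.
  have uf : 'X_[u] * f \is (mdeg u + d).-homog by apply: dhomogM => //; rewrite dhomogX.
  rewrite (dhomog_nemf_coeff uf) ?mulr0 //; change (mdeg m != mdeg u + d)%N.
  by rewrite m2; move: u0; rewrite -mdeg_eq0; lia.
under eq_bigr do rewrite E.
rewrite -big_mkcond; case q0: (0%MM \in msupp q).
  by rewrite -big_filter (_ : filter _ _ = [:: 0%MM]) ?big_seq1 // filter_pred1_uniq.
rewrite big_seq_cond big1 => [|u /andP[uq /eqP u0]]; last by rewrite -u0 uq in q0.
by rewrite (memN_msupp_eq0 (negbT q0)) mul0r.
Qed.

Lemma has_prime_chain1 : (1 < n)%N -> has_prime_chain (invariant_ring n K) 1.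
Proof.
move=> n_gt1.
pose x (i : nat) (j : 'I_n) : {mpoly K[n + n]} := if i is 0 then 'X_(lshift n j) else 0.
pose y (i : nat) (j : 'I_n) : {mpoly K[n + n]} := if i is 0 then 'X_(rshift n j) else 0.
pose A := top_pred (tnth T ord0).
have t_basis := tnth_basis ord0; have t_basis' := t_basis.
apply: (@has_prime_chain_param _ _ 1 _ x y (fun=> tnth T ord0)
  (fun=> config (indicator K A) (indicator K (predC A)))) => [[]|[]|[]|[]] //.
- by move=> v _; exists (fun=> 0); split=> j; rewrite /= mevalXU meval0.
- by move=> _; move: t_basis'; rewrite inE => /andP[].
- move=> _; rewrite /tableau_value; under eq_bigr do rewrite /= !mevalXU !configl !configr.
  by rewrite -/(tableau_value _ _ _) basis_tableau_neq0 // oner_eq0.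
- move=> v _; rewrite /tableau_value.
  have := size_tuple (tnth T ord0); case: (tval _) => [|c s _].
    by move=> /= E; have := half_gt0 n; rewrite n_gt1 -E.
  by rewrite big_cons /= !meval0 !mul0r subrr mul0r.
Qed.

(** The map from quadratic forms to the span of the semistandard tableaux of
    content (2, ..., 2) has a large kernel W, and W is spanned by those f i that
    have degree 2. *)
Lemma quadrics_dim c (f : 'I_c -> {mpoly K[N.+1]}) :
  (forall i, homogeneous_poly (f i)) -> generates_ideal f (kempe_ideal T) ->
  ('C(2 + N, 2) <= c + #|semistandard_set n 2 (2 * n./2)|)%N.
Proof.
move=> f_homog f_gen.
pose U := dhomog N.+1 K 2.
pose psi (u : U) := kempe_map T (mpoly_of_dhomog u).
have psi_lin : linear psi by move=> a u v; rewrite /psi /kempe_map !linearP.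
pose Hpsi := GRing.isLinear.Build _ _ _ _ psi psi_lin.
pose psil : {linear U -> {mpoly K[n + n]}} := HB.pack psi Hpsi.
have [|W dW W0] := @large_kernel _ _ _ psil _
    (fun j : 'I_#|semistandard_set n 2 (2 * n./2)| => tableau_poly K (enum_val j)).
  move=> u; apply/semistandard_spanE/graded_piece_span/kempe_map_graded.
  exact: dhomog_is_dhomog.
rewrite card_ord in dW; have dU : \dim {:U} = 'C(2 + N, 2) by rewrite dimvf.
rewrite -dU; apply: (leq_trans dW); rewrite leq_add2r.
have f_in i : kempe_ideal T (f i).
  apply/f_gen; exists (fun j => (j == i)%:R); rewrite (bigD1 i) //= eqxx mul1r.
  by rewrite big1 ?addr0 // => j /negPf ->; rewrite mul0r.
pose g i : U := @indhomog _ _ 2 (f i).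
suff WS : (W <= <<codom g>>)%VS.
  rewrite (leq_trans (dimvS WS)) // (leq_trans (dim_span _)) //.
  by rewrite size_codom card_ord.
apply/subvP => w /W0 wI.
have [q wE] := (f_gen (mpoly_of_dhomog w)).1 wI.
have -> : w = \sum_i (q i)@_0 *: g i.
  apply: val_inj; rewrite [RHS](raddf_sum \val) /=; apply/mpolyP => m.
  have [m2|m2] := eqVneq (mdeg m) 2%N; last first.
    rewrite (dhomog_nemf_coeff (dhomog_is_dhomog w) m2) raddf_sum big1 // => i _.
    by rewrite /= mcoeffZ (dhomog_nemf_coeff (dhomog_is_dhomog (g i)) m2) mulr0.
  rewrite wE !raddf_sum; apply: eq_bigr => i _; rewrite /= mcoeffZ.
  have [d fd] := f_homog i.
  have [d2|d2] := ltnP d 2.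
    have fi0 := kempe_ideal_low fd (f_in i) d2.
    have -> : g i = 0 by rewrite /g fi0; apply: val_inj; rewrite /indhomog val_insubd if_same.
    by rewrite fi0 mulr0 /= !mcoeff0 mulr0.
  rewrite (quadric_coeff _ fd d2 m2); congr (_ * _).
  rewrite /g /indhomog val_insubd; case: ifP => // /negP f2 /=.
  rewrite mcoeff0 (dhomog_nemf_coeff fd) //; apply: contra_not_neq f2 => md.
  by rewrite -m2 [mdeg m]md.
by apply: memv_suml => i _; apply/memvZ/memv_span/codom_f.
Qed.

Lemma not_complete_intersection : ~~ odd n -> N = (catalan n./2).-1 -> (8 <= n)%N ->
  ~ kempe_complete_intersection K T.
Proof.
move=> n_even NE n8 [d [c [[_ d_max] cdN [f [f_homog f_gen]]]]].
have d1 : (1 <= d)%N by apply/d_max/has_prime_chain1/(leq_trans _ n8).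
have := quadrics_dim f_homog f_gen.
have nE : (2 * n./2 = n)%N by rewrite mul2n even_halfK.
rewrite nE; pose m := (n./2 - 4)%N.
have mE : n = (8 + 2 * m)%N by rewrite /m; lia.
have := card_semistandard2 n; have := riordan_le (2 * m) 0; rewrite -mE.
have := catalan_ge m; have -> : (4 + m = n./2)%N by rewrite /m; lia.
rewrite bin2 mulnC expnM => h1 h2 h3 h4.
have : (2 * ((2 + N) * (2 + N).-1)./2 = (2 + N) * (2 + N).-1)%N.
  by rewrite mul2n even_halfK // add2n oddM /=; case: (odd N).
move: h1 h2 h3 h4; rewrite [((3 ^ 2) ^ m)%N]expnAC; set a := (3 ^ m)%N => h1 h2 h3 h4 h5.
have a0 : (0 < a)%N by rewrite expn_gt0.
have NE' : catalan n./2 = N.+1 by lia.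
have NN : ((a * 14) * (a * 14 - 1) <= N.+1 * N)%N by apply: leq_mul; lia.
have aa : (a <= a ^ 2)%N by rewrite leq_pmulr.
have aE : ((a * 14) * (a * 14 - 1) = 196 * a ^ 2 - 14 * a)%N by nia.
rewrite add2n /= in h4 h5; rewrite muln1 in h2.
have cN : (c <= N)%N by lia.
have E : (N.+2 * N.+1 = N.+1 * N + 2 * N.+1)%N by nia.
rewrite E in h5; rewrite aE in NN.
have h6 := leq_trans h4 (leq_add cN (leq_trans h3 h2)).
have : (2 * (N.+2 * N.+1)./2 <= 2 * (N + 91 * a ^ 2))%N by rewrite leq_mul2l.
rewrite h5; lia.
Qed.
End NotCompleteIntersection.

(** * Hypersurfaces linear in one variable *)
Section LinearHypersurface.
Local Open Scope ring_scope.
Variables (K : numFieldType) (m : nat).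
Implicit Types (p q r : {mpoly K[m]}) (v : 'I_m -> K).

Lemma mpoly_ring_ind (P : {mpoly K[m]} -> Prop) :
  (forall c, P c%:MP) -> (forall i, P 'X_i) ->
  (forall p q, P p -> P q -> P (p + q)) -> (forall p q, P p -> P q -> P (p * q)) ->
  forall p, P p.
Proof.
move=> PC PX PD PM p; rewrite [p]mpolyE.
apply: (big_ind P) => // [|u _]; first by rewrite -mpolyC0.
rewrite -mul_mpolyC mpolyXE_id; apply: (PM) => //.
apply: (big_ind P) => // [|i _]; first by rewrite -mpolyC1.
by elim: (u i) => [|k IH]; rewrite ?expr0 -?mpolyC1 // exprS; apply: PM.
Qed.

(** The substitution of 0 for X_j. The polynomials that it fixes are those in
    which X_j does not occur. *)
Definition kill_var (j : 'I_m) : m.-tuple {mpoly K[m]} :=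
  mktuple (fun i => if i == j then 0 else 'X_i).

Local Notation kill j p := (p \mPo kill_var j).

Lemma killX j i : kill j 'X_i = if i == j then 0 else 'X_i.
Proof. by rewrite comp_mpolyXU -tnth_nth tnth_mktuple. Qed.

Lemma kill_eval j p v : (kill j p).@[v] = p.@[fun i => if i == j then 0 else v i].
Proof.
rewrite comp_mpoly_meval; apply: meval_eq => i; rewrite tnth_mktuple.
by case: ifP => _; rewrite ?meval0 ?mevalXU.
Qed.

Lemma kill_divides j p : exists g, p = kill j p + 'X_j * g.
Proof.
elim/mpoly_ring_ind: p => [c|i|p q [g pE] [h qE]|p q [g pE] [h qE]].
- by exists 0; rewrite comp_mpolyC mulr0 addr0.
- rewrite killX; case: eqVneq => [->|_]; first by exists 1; rewrite add0r mulr1.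
  by exists 0; rewrite mulr0 addr0.
- by exists (g + h); rewrite {1}pE {1}qE rmorphD mulrDr addrACA.
- exists (g * q + kill j p * h); rewrite rmorphM mulrDr addrCA addrA [LHS]mulrC.
  rewrite {1}pE mulrDr; set kp := kill j p; set kq := kill j q.
  rewrite [X in X + _](_ : _ = kp * kq + 'X_j * (kp * h)); first by ring.
  by rewrite {1}qE -/kq; ring.
Qed.

(** Modulo X_j A + B the variable X_j is -B/A, and a power of A clears the
    denominators. *)
Lemma pseudo_division j A B p : kill j A = A -> kill j B = B ->
  exists k q r, A ^+ k * p = q * ('X_j * A + B) + r /\ kill j r = r.
Proof.
move=> kA kB; set F := 'X_j * A + B.
elim/mpoly_ring_ind: p => [c|i|p p' [k [q [r [E kr]]]] [k' [q' [r' [E' kr']]]]|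
    p p' [k [q [r [E kr]]]] [k' [q' [r' [E' kr']]]]].
- by exists 0%N, 0, c%:MP; rewrite mul1r mul0r add0r comp_mpolyC.
- have [->|ij] := eqVneq i j.
    exists 1%N, 1, (- B); rewrite comp_mpolyN kB; split=> //.
    by rewrite /F; ring.
  by exists 0%N, 0, 'X_i; rewrite mul1r mul0r add0r killX (negPf ij).
- exists (k + k')%N, (A ^+ k' * q + A ^+ k * q'), (A ^+ k' * r + A ^+ k * r').
  rewrite !(rmorphD, rmorphM, rmorphXn) /= kA kr kr'; split=> //.
  rewrite mulrDr exprD {1}[A ^+ k * _]mulrC -!mulrA E E'.
  by move: (A ^+ k) (A ^+ k') => a a'; ring.
- exists (k + k')%N, (q * q' * F + q * r' + r * q'), (r * r').
  rewrite rmorphM /= kr kr'; split=> //.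
  by rewrite exprD mulrACA E E'; ring.
Qed.

(** The set S lies on the hypersurface and projects onto the general points of
    the hyperplane of coordinates other than j. Pseudo-division of p leaves a
    remainder without X_j that vanishes at all general points, so it is 0 and
    A ^ k * p is a multiple of X_j A + B. The factors A are then cancelled one by
    one: a multiple q (X_j A + B) divisible by A has q B divisible by A, hence q
    divisible by A because B is regular modulo A. *)
Lemma linear_hypersurface (S : ('I_m -> K) -> Prop) j A B D :
  kill j A = A -> kill j B = B -> A != 0 -> D != 0 ->
  (forall h g, B * h = A * g -> exists g', h = A * g') ->
  (forall v, S v -> ('X_j * A + B).@[v] = 0) ->
  (forall v, D.@[v] != 0 -> exists2 u, S u & forall i, i != j -> u i = v i) ->
  forall p, (forall v, S v -> p.@[v] = 0) -> exists q, p = q * ('X_j * A + B).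
Proof.
move=> kA kB A0 D0 AB SF SD p Sp; set F := 'X_j * A + B.
have [k [q [r [E kr]]]] := pseudo_division p kA kB.
have r0 : r = 0.
  apply: (mpoly_vanish_off D0) => v /SD[u Su uv].
  have -> : r.@[v] = r.@[u].
    rewrite -kr !kill_eval; apply: meval_eq => i.
    by case: eqVneq => // /uv.
  have -> : r = A ^+ k * p - q * F by rewrite E addrC addKr.
  by rewrite mevalB !mevalM Sp // SF // !mulr0 subr0.
rewrite r0 addr0 in E; elim: k q E => [|k IH] q E.
  by exists q; rewrite -E mul1r.
have [g' qE] : exists g', q = A * g'.
  apply: (AB _ (A ^+ k * p - q * 'X_j)).
  rewrite mulrBr mulrA -exprS E; ring.
apply: (IH g'); apply: (mulfI A0); rewrite mulrA -exprS E qE; ring.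
Qed.
End LinearHypersurface.

(** * The Kempe ideal as the ideal of the values of tableaux *)
Section KempePoints.
Local Open Scope ring_scope.
Variables (K : numFieldType) (n N : nat) (T : N.+1.-tuple (tableau n n./2)).

Lemma kempe_idealP (p : {mpoly K[N.+1]}) :
  kempe_ideal T p <->
  forall x y : 'I_n -> K, p.@[fun i => tableau_value x y (tnth T i)] = 0.
Proof.
have E x y : (kempe_map T p).@[config x y] = p.@[fun i => tableau_value x y (tnth T i)].
  rewrite comp_mpoly_meval; apply: meval_eq => i.
  by rewrite kempe_tnth tableau_poly_value.
split=> [p0 x y|p0]; first by rewrite -E [kempe_map _ _]p0 meval0.
apply: mpoly_vanish => v; rewrite -(p0 (fun i => v (lshift n i)) (fun i => v (rshift n i))) -E.
exact/meval_eq/config_eta.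
Qed.

Lemma kempe_ideal_dominant :
  (forall u : 'I_N.+1 -> K, exists x y, forall i, tableau_value x y (tnth T i) = u i) ->
  forall p : {mpoly K[N.+1]}, kempe_ideal T p <-> p = 0.
Proof.
move=> dom p; split=> [/kempe_idealP p0|->]; last exact: comp_mpoly0.
apply: mpoly_vanish => u; have [x [y xyu]] := dom u.
by rewrite -(p0 x y); apply: meval_eq => i; rewrite xyu.
Qed.

Lemma dominant_complete_intersection :
  krull_dim_is (invariant_ring n K) N.+1 ->
  (forall u : 'I_N.+1 -> K, exists x y, forall i, tableau_value x y (tnth T i) = u i) ->
  kempe_complete_intersection K T.
Proof.
move=> dimR dom; exists N.+1, 0%N; split=> //; exists (fun=> 0).
split=> [[]//|p]; rewrite (kempe_ideal_dominant dom).
by split=> [->|[q ->]]; [exists (fun=> 0)|]; rewrite big_ord0.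
Qed.

Lemma krull_dim_invariant_ring :
  has_prime_chain (invariant_ring n K) (n - 3).+1 ->
  krull_dim_is (invariant_ring n K) (n - 3).+1.
Proof. by move=> chain; split=> // e /krull_dim_invariant_ring_le. Qed.
End KempePoints.

Section Enumerate.
Variables (n N : nat) (T : N.+1.-tuple (tableau n n./2)).
Hypothesis T_basis : perm_eq T (enum (basis_tableaux n)).

Lemma basis_enum (L : seq (tableau n n./2)) :
  uniq L -> size L = N.+1 -> {subset L <= basis_tableaux n} -> T =i L.
Proof.
move=> L_uniq L_size LB t.
have LT : {subset L <= T} by move=> u /LB; rewrite (mem_kempe_tuple T_basis).
have [|_ -> //] := uniq_min_size L_uniq LT.
by rewrite size_tuple L_size.
Qed.
End Enumerate.

(** * The Segre cubic *)
Section Segre.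
Local Open Scope ring_scope.
Variables (K : numFieldType) (m : nat) (a b c d e : 'I_m).
Hypothesis abcde : uniq [:: a; b; c; d; e].
Local Notation V i := ('X_i : {mpoly K[m]}).

Definition quadric : {mpoly K[m]} := V e * V b + - (V c * V d).
Definition cubic : {mpoly K[m]} := V b * (V d - V e) * (V e - V c).
Definition segre : {mpoly K[m]} := V a * quadric + - cubic.

Let distinct : ((b == a = false) * (c == a = false) * (d == a = false) * (e == a = false) *
  (c == b = false) * (d == b = false) * (b == e = false) * (c == e = false) *
  (d == e = false))%type.
Proof.
move: abcde; rewrite /= !inE !negb_or.
move=> /and5P[/and4P[ab ac ad ae] /and3P[bc bd be] /andP[cd ce] de _].
by do 8?split; apply/negbTE; rewrite // eq_sym.
Qed.

Local Notation kill j p := (p \mPo kill_var K j).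

Lemma eval_nonzero (p : {mpoly K[m]}) v : p.@[v] != 0 -> p != 0.
Proof. by apply: contraNneq => ->; rewrite meval0. Qed.

Lemma var_neq0 i : V i != 0.
Proof. by apply: (@eval_nonzero _ (fun=> 1)); rewrite mevalXU oner_eq0. Qed.

Let point (u : seq K) (i : 'I_m) : K := nth 0 u (index i [:: a; b; c; d; e]).

Let pointE u : (point u a = u`_0) * (point u b = u`_1) * (point u c = u`_2)
  * (point u d = u`_3) * (point u e = u`_4).
Proof.
have E k : (k < 5)%N -> point u (nth a [:: a; b; c; d; e] k) = u`_k.
  by move=> k5; rewrite /point index_uniq.
by rewrite -!E.
Qed.

(** The quadric is prime and does not divide the cubic. In the form needed here:
    h vanishes at the points of the quadric outside the cubic, and these project
    onto the general points in the coordinates other than e, since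
    X_e = X_c X_d / X_b on the quadric. *)
Lemma quadric_prime h g : - cubic * h = quadric * g -> exists g', h = quadric * g'.
Proof.
move=> E.
(* With X_e = X_c X_d / X_b the cubic becomes D / X_b^2. *)
pose D : {mpoly K[m]} := V b * V c * V d * (V b - V c) * (V d - V b).
pose S (v : 'I_m -> K) := quadric.@[v] = 0 /\ cubic.@[v] != 0.
have [||||g1 g2 bg|v [Qv _]|v Dv|v [Qv Cv]|q qE] :=
    @linear_hypersurface K m S e (V b) (- (V c * V d)) D _ _ _ _ _ _ _ h _.
- by rewrite killX distinct.
- by rewrite rmorphN rmorphM /= !killX !distinct.
- exact: var_neq0.
- apply: (@eval_nonzero _ (point [:: 0; 1; 2; 2; 0])).
  rewrite !(mevalM, mevalB, mevalXU) !pointE /=.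
  by rewrite [X in X != 0](_ : _ = - 4%:R) ?oppr_eq0 ?pnatr_eq0 //; ring.
- have b0 : kill b g1 = 0.
    have : kill b (- (V c * V d) * g1) = kill b (V b * g2) by rewrite bg.
    rewrite !rmorphM rmorphN rmorphM /= !killX eqxx !distinct mul0r => /eqP.
    rewrite mulf_eq0 oppr_eq0 mulf_eq0; by rewrite !(negPf (var_neq0 _)) => /eqP.
  have [g' gE] := kill_divides b g1; exists g'.
  by rewrite gE b0 add0r.
- exact: Qv.
- have : v b * v c * v d * (v b - v c) * (v d - v b) != 0.
    by move: Dv; rewrite !(mevalM, mevalB, mevalXU).
  rewrite !mulf_eq0 !negb_or -!andbA => /and5P[b0 c0 d0 bc db].
  exists (fun i => if i == e then v c * v d / v b else v i); last by move=> i /negPf ->.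
  split; rewrite /quadric /cubic !(mevalD, mevalN, mevalM, mevalB, mevalXU) !distinct eqxx.
    by field.
  have -> : v b * (v d - v c * v d / v b) * (v c * v d / v b - v c) =
      v c * v d * (v b - v c) * (v d - v b) / v b by field.
  by rewrite !mulf_neq0 ?invr_neq0.
- have := congr1 (meval v) E; rewrite !mevalM mevalN Qv mul0r => /eqP.
  by rewrite mulf_eq0 oppr_eq0 (negPf Cv) => /eqP.
by exists q; rewrite qE mulrC.
Qed.

Lemma segre_prime (S : ('I_m -> K) -> Prop) :
  (forall v, S v -> segre.@[v] = 0) ->
  (forall v, (v b - v c) * (v d - v e - v b + v c) * (v b * v e - v c * v d) != 0 ->
     exists2 u, S u & forall i, i != a -> u i = v i) ->
  forall p : {mpoly K[m]}, (forall v, S v -> p.@[v] = 0) -> exists q, p = q * segre.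
Proof.
move=> S_segre S_dom p Sp.
pose D : {mpoly K[m]} := (V b - V c) * (V d - V e - V b + V c) * (V b * V e - V c * V d).
apply: (@linear_hypersurface K m S a quadric (- cubic) D) => //.
- by rewrite /quadric !(rmorphD, rmorphN, rmorphM) /= !killX !distinct.
- by rewrite /cubic !(rmorphB, rmorphN, rmorphM) /= !killX !distinct.
- apply: (@eval_nonzero _ (point [:: 0; 1; 0; 0; 1])).
  rewrite /quadric !(mevalD, mevalN, mevalM, mevalB, mevalXU) !pointE /=.
  by rewrite mulr0 subr0 mulr1 oner_eq0.
- apply: (@eval_nonzero _ (point [:: 0; 1; 0; 0; 1])).
  rewrite /D !(mevalD, mevalN, mevalM, mevalB, mevalXU) !pointE /=.
  by rewrite [X in X != 0](_ : _ = - 2%:R) ?oppr_eq0 ?pnatr_eq0 //; ring.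
- exact: quadric_prime.
- by move=> v Dv; apply: S_dom; move: Dv; rewrite !(mevalD, mevalN, mevalM, mevalB, mevalXU).
Qed.

Lemma segre_homog : segre \is 3.-homog.
Proof.
have XH i : V i \is 1.-homog by rewrite dhomogX /= mdeg1.
have M2 (p q : {mpoly K[m]}) k l : p \is k.-homog -> q \is l.-homog -> forall d, d = (k + l)%N ->
    p * q \is d.-homog by move=> pk ql _ ->; apply: dhomogM.
have D2 (p q : {mpoly K[m]}) k : p \is k.-homog -> q \is k.-homog -> p + q \is k.-homog.
  by move=> pk qk; apply: dhomogD.
have N2 (p : {mpoly K[m]}) k : p \is k.-homog -> - p \is k.-homog by rewrite dhomogN.
have Q2 : quadric \is 2.-homog by apply: D2; [|apply: N2]; apply: (M2 _ _ 1%N 1%N).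
have DB i j : V i - V j \is 1.-homog by apply: D2; last exact: N2.
have C3 : cubic \is 3.-homog.
  by apply: (M2 _ _ 2%N 1%N) => //; apply: (M2 _ _ 1%N 1%N).
by apply: D2; [apply: (M2 _ _ 1%N 2%N)|apply: N2].
Qed.
End Segre.

(** * The cases n = 2, 4, 6 *)
Section SmallCases.
Local Open Scope ring_scope.
Variable K : numFieldType.

Lemma two_points (T : 1.-tuple (tableau 2 2./2)) :
  perm_eq T (enum (basis_tableaux 2)) -> kempe_complete_intersection K T.
Proof.
move=> T_basis; apply: dominant_complete_intersection.
  by apply: krull_dim_invariant_ring; apply: has_prime_chain1 T_basis _.
move=> u; have := tnth_basis T_basis ord0; rewrite inE => /andP[/and3P[ts _ _] _].
exists (fun j => (j == 0 :> nat)%:R), (fun j => if j == 0 :> nat then 0 else u ord0).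
move=> i; rewrite (ord1 i); move: ts; case: (tnth T ord0) => [[|[c1 c2] [|? ?]] //= _].
rewrite andbT /tableau_value big_seq1 /=.
by case: c1 c2 => [[|[|]] //= _] [[|[|]] //= _] _; rewrite mulr0 subr0 mul1r.
Qed.

Local Notation "k '%4" := (@Ordinal 4 k isT) (at level 2).
Local Notation "k '%6" := (@Ordinal 6 k isT) (at level 2).

(** A form of the condition that computes when the entries are numerals. *)
Lemma equicontent1_check n (t : tableau n n./2) :
  all (fun k => count_mem k (map val (top_row t ++ bottom_row t)) == 1%N) (iota 0 n) ->
  equicontent 1 t.
Proof.
move=> /allP tc; apply/forallP => i; have := tc i; rewrite mem_iota ltn_ord => /(_ isT).
by rewrite count_map.
Qed.

Lemma four_points (T : 2.-tuple (tableau 4 4./2)) :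
  perm_eq T (enum (basis_tableaux 4)) -> kempe_complete_intersection K T.
Proof.
move=> T_basis.
pose ta : tableau 4 4./2 := [tuple (0'%4, 1'%4); (2'%4, 3'%4)].
pose tb : tableau 4 4./2 := [tuple (0'%4, 2'%4); (1'%4, 3'%4)].
have TE : T =i [:: ta; tb].
  apply: (basis_enum T_basis) => // t; rewrite !inE => /orP[] /eqP ->.
    by rewrite equicontent1_check.
  by rewrite equicontent1_check.
apply: dominant_complete_intersection; last first.
  have /tnthP[a aE] : ta \in T by rewrite TE !inE eqxx.
  have /tnthP[b bE] : tb \in T by rewrite TE !inE eqxx orbT.
  move=> u; exists (nth 0 [:: 1; 1; 1; 0]), (nth 0 [:: 0; u a; u b; 1]) => i.
  have : tnth T i \in T by apply: mem_tnth.
  have T_inj := tuple_uniqP _ (kempe_tuple_uniq T_basis).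
  rewrite TE !inE => /orP[] /eqP tE; rewrite tE.
    have -> : i = a by apply: T_inj; rewrite tE.
    by rewrite /tableau_value big_cons big_seq1 /=; ring.
  have -> : i = b by apply: T_inj; rewrite tE.
  by rewrite /tableau_value big_cons big_seq1 /=; ring.
apply: krull_dim_invariant_ring.
(* The points (s,0), (0,1), (z,1), (1,1), specialised to z = 0 and then to s = 0. *)
pose z i : {mpoly K[2]} := if (1 <= i)%N then 0 else 'X_ord0.
pose s i : {mpoly K[2]} := if (2 <= i)%N then 0 else 'X_ord_max.
pose x i (j : 'I_4) := nth 0 [:: s i; 0; z i; 1] j.
pose y (i : nat) (j : 'I_4) := nth 0 [:: 0; 1; 1; 1] j : {mpoly K[2]}.
pose t i : tableau 4 4./2 := if i is 0 then [tuple (1'%4, 2'%4); (0'%4, 3'%4)]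
  else [tuple (0'%4, 2'%4); (1'%4, 3'%4)].
apply: (@has_prime_chain_param _ _ _ _ x y t (fun=> fun=> 2%:R)).
- move=> i v i2; exists (fun k => if k == 0 :> nat then (z i.+1).@[v] else (s i.+1).@[v]).
  case: i i2 => [|[|i]] // _; split; case=> [[|[|[|[|k]]]] kH] //=;
    by rewrite ?(meval0, meval1, mevalXU).
- case=> [|[|i]] i2; [apply: (equicontent1_check (t := t 0%N))|apply: (equicontent1_check (t := t 1%N))|] => //.
- case=> [|[|i]] // _; rewrite /tableau_value big_cons big_seq1 /=
    !(meval0, meval1, mevalXU) ?(mul0r, mulr0, mul1r, mulr1, sub0r, subr0).
    by rewrite mulf_neq0 ?oppr_eq0 ?pnatr_eq0.
  by rewrite mulf_neq0 ?oppr_eq0 ?pnatr_eq0 ?oner_eq0.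
- case=> [|[|i]] v // _; rewrite /tableau_value big_cons big_seq1 /=
    !(meval0, meval1, mevalXU); ring.
Qed.

(** The six points, as vectors (x, y), are (s,0), (0,1), (z3,1), (z4,1), (z5,1),
    (1,1). The chain specialises z5 = 0, z4 = 1, z3 = 0 and s = 0 in turn, so the
    points 2, 5, then 4, 6, then 2, 3 come together. Before s = 0 at most three
    of the six points coincide, so some perfect matching of distinct points
    survives, and the invariants do not all vanish. *)
Lemma krull_dim_6 : krull_dim_is (invariant_ring 6 K) 4.
Proof.
apply: krull_dim_invariant_ring.
pose V k (H : (k < 4)%N) : {mpoly K[4]} := 'X_(Ordinal H).
pose z5 i : {mpoly K[4]} := if (1 <= i)%N then 0 else V 0%N isT.
pose z4 i : {mpoly K[4]} := if (2 <= i)%N then 1 else V 1%N isT.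
pose z3 i : {mpoly K[4]} := if (3 <= i)%N then 0 else V 2%N isT.
pose s i : {mpoly K[4]} := if (4 <= i)%N then 0 else V 3%N isT.
pose x i (j : 'I_6) := nth 0 [:: s i; 0; z3 i; z4 i; z5 i; 1] j.
pose y (i : nat) (j : 'I_6) := nth 0 [:: 0; 1; 1; 1; 1; 1] j : {mpoly K[4]}.
pose t i : tableau 6 6./2 := nth [tuple (1'%6, 3'%6); (4'%6, 5'%6); (0'%6, 2'%6)]
  [:: [tuple (1'%6, 4'%6); (0'%6, 2'%6); (3'%6, 5'%6)];
      [tuple (3'%6, 5'%6); (0'%6, 1'%6); (2'%6, 4'%6)];
      [tuple (1'%6, 2'%6); (0'%6, 3'%6); (4'%6, 5'%6)]] i.
apply: (@has_prime_chain_param _ _ _ _ x y t (fun=> fun=> 2%:R)).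
- move=> i v i4; exists (fun k => nth 0
    [:: (z5 i.+1).@[v]; (z4 i.+1).@[v]; (z3 i.+1).@[v]; (s i.+1).@[v]] k).
  case: i i4 => [|[|[|[|i]]]] // _; split; case=> [[|[|[|[|[|[|k]]]]]] kH] //=;
    by rewrite ?(meval0, meval1, mevalXU).
- by case=> [|[|[|[|i]]]] i4; [exact: (equicontent1_check (t := t 0%N))
    |exact: (equicontent1_check (t := t 1%N))|exact: (equicontent1_check (t := t 2%N))
    |exact: (equicontent1_check (t := t 3%N))|].
- case=> [|[|[|[|i]]]] // _; rewrite /tableau_value !big_cons big_nil /=
    !(meval0, meval1, mevalXU).
  + by rewrite [X in X != 0](_ : _ = - 4%:R) ?oppr_eq0 ?pnatr_eq0 //; ring.
  + by rewrite [X in X != 0](_ : _ = 4%:R) ?pnatr_eq0 //; ring.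
  + by rewrite [X in X != 0](_ : _ = 4%:R) ?pnatr_eq0 //; ring.
  + by rewrite [X in X != 0](_ : _ = 2%:R) ?pnatr_eq0 //; ring.
- case=> [|[|[|[|i]]]] v // _; rewrite /tableau_value !big_cons big_nil /=
    !(meval0, meval1, mevalXU); ring.
Qed.

(** By the Pluecker relation each of d - e, e - c and e b - c d is, up to sign, a
    single product of brackets; both sides are then the same product of nine
    brackets. *)
Lemma segre_value (x y : 'I_6 -> K) :
  let p i j := x i * y j - x j * y i in
  let a := p 0'%6 3'%6 * (p 1'%6 4'%6 * p 2'%6 5'%6) in
  let b := p 0'%6 2'%6 * (p 1'%6 4'%6 * p 3'%6 5'%6) in
  let c := p 0'%6 2'%6 * (p 1'%6 3'%6 * p 4'%6 5'%6) in
  let d := p 0'%6 1'%6 * (p 2'%6 4'%6 * p 3'%6 5'%6) in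
  let e := p 0'%6 1'%6 * (p 2'%6 3'%6 * p 4'%6 5'%6) in
  a * (e * b - c * d) = b * (d - e) * (e - c).
Proof.
move: (0'%6) (1'%6) (2'%6) (3'%6) (4'%6) (5'%6) => i1 i2 i3 i4 i5 i6 p a b c d e.
have P i j k l : p i l * p j k = p i k * p j l - p i j * p k l by rewrite /p; ring.
have E1 : d - e = p i1 i2 * (p i3 i6 * p i4 i5).
  by rewrite P /d /e; ring.
have E2 : e - c = - (p i5 i6 * (p i1 i4 * p i2 i3)).
  by rewrite P /e /c; ring.
have E3 : e * b - c * d = - (p i1 i2 * p i1 i3 * p i4 i6 * p i5 i6 * (p i2 i3 * p i4 i5)).
  rewrite (_ : p i2 i3 * p i4 i5 = p i2 i4 * p i3 i5 - p i2 i5 * p i3 i4); last first.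
    by rewrite /p; ring.
  by rewrite /e /b /c /d; ring.
by rewrite E1 E2 E3 /a /b; ring.
Qed.

Lemma six_points (T : 5.-tuple (tableau 6 6./2)) :
  perm_eq T (enum (basis_tableaux 6)) -> kempe_complete_intersection K T.
Proof.
move=> T_basis.
pose ta : tableau 6 6./2 := [tuple (0'%6, 3'%6); (1'%6, 4'%6); (2'%6, 5'%6)].
pose tb : tableau 6 6./2 := [tuple (0'%6, 2'%6); (1'%6, 4'%6); (3'%6, 5'%6)].
pose tc : tableau 6 6./2 := [tuple (0'%6, 2'%6); (1'%6, 3'%6); (4'%6, 5'%6)].
pose td : tableau 6 6./2 := [tuple (0'%6, 1'%6); (2'%6, 4'%6); (3'%6, 5'%6)].
pose te : tableau 6 6./2 := [tuple (0'%6, 1'%6); (2'%6, 3'%6); (4'%6, 5'%6)].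
have TE : T =i [:: ta; tb; tc; td; te].
  apply: (basis_enum T_basis) => // t; rewrite !inE.
  by case/or4P => [|||/orP[]] /eqP ->; rewrite equicontent1_check.
have /tnthP[a aE] : ta \in T by rewrite TE !inE eqxx.
have /tnthP[b bE] : tb \in T by rewrite TE !inE eqxx.
have /tnthP[c cE] : tc \in T by rewrite TE !inE eqxx.
have /tnthP[d dE] : td \in T by rewrite TE !inE eqxx.
have /tnthP[e eE] : te \in T by rewrite TE !inE eqxx.
have abcde : uniq [:: a; b; c; d; e].
  by apply: (@map_uniq _ _ (tnth T)); rewrite /= -aE -bE -cE -dE -eE.
pose S (v : 'I_5 -> K) := exists x y, forall i, v i = tableau_value x y (tnth T i).
have S_segre v : S v -> (segre K a b c d e).@[v] = 0.
  case=> x [y vE]; rewrite /segre /quadric /cubic.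
  rewrite !(mevalD, mevalN, mevalM, mevalB, mevalXU) !vE -aE -bE -cE -dE -eE.
  rewrite /tableau_value !big_cons !big_nil !mulr1 /=.
  by apply/eqP; rewrite subr_eq0; apply/eqP/segre_value.
have S_dom (v : 'I_5 -> K) :
    (v b - v c) * (v d - v e - v b + v c) * (v b * v e - v c * v d) != 0 ->
    exists2 u, S u & forall i, i != a -> u i = v i.
  rewrite !mulf_eq0 !negb_or -andbA => /and3P[bc L0 Q0].
  (* Normalise the first point to (1, 0), the last to (0, 1), and scale the
     others. If the second point is (1, u) and the third (w, 1), the values at b
     and c give the fourth and the fifth in terms of u; the difference of the
     values at d and e gives w u, and then the value at d gives u. *)
  pose u := (v b * v e - v c * v d) / (v d - v e - v b + v c).
  pose w := (v d - v e) / (v b - v c) / u.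
  pose x := nth 0 [:: 1; 1; w; 1; 1; 0] \o val : 'I_6 -> K.
  pose y := nth 0 [:: 0; u; 1; v c + u; v b + u; 1] \o val : 'I_6 -> K.
  exists (fun i => tableau_value x y (tnth T i)); first by exists x, y.
  move=> i ia; have : tnth T i \in T by apply: mem_tnth.
  have T_inj := tuple_uniqP _ (kempe_tuple_uniq T_basis).
  have xyE : [/\ tableau_value x y tb = v b, tableau_value x y tc = v c,
      tableau_value x y td = v d & tableau_value x y te = v e].
    rewrite /tableau_value !big_cons !big_nil /x /y /=; split.
    - ring.
    - ring.
    - rewrite /w /u; field; by rewrite L0 Q0 bc.
    - rewrite /w /u; field; by rewrite L0 Q0 bc.
  case: xyE => xb xc xd xe.
  rewrite TE !inE; case/or4P => [|||/orP[]] /eqP tE; rewrite tE ?xb ?xc ?xd ?xe;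
    [by case/eqP: ia; apply: T_inj; rewrite tE| | | |];
    by congr (v _); apply: T_inj; rewrite tE.
exists 4%N, 1%N; split => //; first exact: krull_dim_6.
exists (fun=> segre K a b c d e); split.
  by move=> _; exists 3%N; apply: segre_homog.
move=> p; split.
  move/kempe_idealP => p0.
  have [|q ->] := segre_prime abcde S_segre S_dom (p := p).
    by move=> v [x [y vE]]; rewrite -(p0 x y); apply: meval_eq.
  by exists (fun=> q); rewrite big_ord1.
case=> q ->; rewrite big_ord1; apply/kempe_idealP => x y.
by rewrite mevalM S_segre ?mulr0 //; exists x, y.
Qed.
End SmallCases.

Theorem theorem4p14 (R : realType) (n N : nat)
    (n_ge2 : 2 <= n) (n_even : ~~ odd n) (N_def : N = (catalan n./2).-1)
    (T : N.+1.-tuple (tableau n n./2))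
    (T_enum : perm_eq T (enum (basis_tableaux n))) :
  (8 <= n -> ~ kempe_complete_intersection R[i] T) /\
  (n \in [:: 2; 4; 6] -> kempe_complete_intersection R[i] T).
Proof.
split=> [n8|]; first exact: (@not_complete_intersection R[i] n N T T_enum n_even N_def n8).
rewrite !inE => /or3P[] /eqP n_eq; subst n.
- have N0 : N = 0 by rewrite N_def; vm_compute.
  by subst N; apply: (@two_points R[i] T T_enum).
- have N1 : N = 1 by rewrite N_def; vm_compute.
  by subst N; apply: (@four_points R[i] T T_enum).
- have N4 : N = 4 by rewrite N_def; vm_compute.
  by subst N; apply: (@six_points R[i] T T_enum).
Qed.
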